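(* Let $R$ be a maximal subring of a ring $T$ and let $R$ be a left Artinian ring. Assume that $(R:T)_l=(R:T)=(R:T)_r$. Then $T/(R:T)\cong \mathbb{M}_n(S)$ for some ring $S$ and a natural number $n$, where $S$ has a maximal subring which is a division ring. Moreover, either $T$ is a left Artinian ring (in particular, $J(R)=J(T)\cap R$), or $S$ (and also $T/(R:T)$) has at most one nonzero proper ideal and one of the following holds: (1) $S$ is a simple ring, i.e., $(R:T)$ is a maximal ideal of $T$. (2) $S$ has a unique nonzero proper ideal $M$ and $M^2=0$. In particular, $J(S)=M$. (3) $S$ has a unique nonzero proper ideal $M$ and $M^2=M$. In particular, either $S$ is a primitive ring or $J(S)=M$. Moreover, if $Q$ is the unique maximal ideal of $T$ which contains $(R:T)$ in items (1)-(3), then the following hold: (a) $Max(T)=\{Q\}\cup \{N\in Spec(T)\mid N\nsubseteq R\}$. (b) Each prime ideal of $T$ is either maximal or is contained in $Q$. In particular, $dim(T)=ht(Q)$. (c) If $N_1$ and $N_2$ are distinct maximal ideals of $T$ and $N_i\neq Q$ for $i=1,2$, then $N_1\cap R\neq N_2\cap R$. (d) $|Max(T)|\leq |Max(R)|$.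
   Context: All rings are associative and unital (not necessarily commutative), and subrings contain the identity of the big ring; ''ideal'' means two-sided ideal. A maximal subring $R$ of $T$ is a proper subring with no subring strictly between $R$ and $T$. Conductors: $(R:T)=\{x\in T: TxT\subseteq R\}$, $(R:T)_l=\{x\in T: Tx\subseteq R\}$, $(R:T)_r=\{x\in T: xT\subseteq R\}$. $\mathbb{M}_n(S)$ is the ring of $n\times n$ matrices over $S$. $J$ is the Jacobson radical; $Spec$ and $Max$ denote the sets of prime and maximal ideals; $dim$ is the classical Krull dimension (supremum of lengths of chains of prime ideals) and $ht(Q)$ is the height of $Q$ (supremum of lengths of chains of prime ideals descending from $Q$). *)

(* Defs.v *)
From HB Require Import structures.
From mathcomp Require Import all_boot all_algebra all_classical.

Set Implicit Arguments.
Unset Strict Implicit.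
Unset Printing Implicit Defensive.

Import GRing.Theory.
Local Open Scope classical_set_scope.
Local Open Scope ring_scope.

(* "Ring" means pzRingType: associative, unital, not necessarily commutative,  *)
(* and possibly zero; nontriviality is stated where a definition requires it.  *)
(* Ideals are classical sets, subrings are MathComp's subringClosed predicates.*)

Definition is_left_ideal (T : pzRingType) (I : set T) : Prop :=
  [/\ I 0, forall x y, I x -> I y -> I (x - y) &
      forall t x, I x -> I (t * x)].

Definition is_ideal (T : pzRingType) (I : set T) : Prop :=
  [/\ I 0, forall x y, I x -> I y -> I (x - y),
      forall t x, I x -> I (t * x) & forall t x, I x -> I (x * t)].

Definition ideal_mul (T : pzRingType) (I J : set T) : set T :=
  [set x | exists n (a b : 'I_n -> T),
    [/\ forall i, I (a i), forall i, J (b i) & x = \sum_i a i * b i]].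

Definition is_maximal_left_ideal (T : pzRingType) (M : set T) : Prop :=
  [/\ is_left_ideal M, M <> setT &
      forall I, is_left_ideal I -> M `<=` I -> I = M \/ I = setT].

Definition is_maximal_ideal (T : pzRingType) (M : set T) : Prop :=
  [/\ is_ideal M, M <> setT &
      forall I, is_ideal I -> M `<=` I -> I = M \/ I = setT].

Definition is_prime_ideal (T : pzRingType) (P : set T) : Prop :=
  [/\ is_ideal P, P <> setT &
      forall I J, is_ideal I -> is_ideal J ->
        ideal_mul I J `<=` P -> I `<=` P \/ J `<=` P].

Definition Spec (T : pzRingType) : set (set T) := [set P | is_prime_ideal P].
Definition Max (T : pzRingType) : set (set T) := [set M | is_maximal_ideal M].

Definition jacobson (T : pzRingType) : set T :=
  [set x | forall M, is_maximal_left_ideal M -> M x].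

Arguments Spec : clear implicits.
Arguments Max : clear implicits.
Arguments jacobson : clear implicits.

Definition nonzero_proper_ideal (T : pzRingType) (I : set T) : Prop :=
  [/\ is_ideal I, I <> [set 0] & I <> setT].

Definition at_most_one_nonzero_proper_ideal (T : pzRingType) : Prop :=
  forall I J : set T,
    nonzero_proper_ideal I -> nonzero_proper_ideal J -> I = J.

Definition unique_nonzero_proper_ideal (T : pzRingType) (M : set T) : Prop :=
  nonzero_proper_ideal M /\ forall I, nonzero_proper_ideal I -> I = M.

Definition left_artinian (T : pzRingType) : Prop :=
  forall I : nat -> set T,
    (forall k, is_left_ideal (I k)) -> (forall k, I k.+1 `<=` I k) ->
    exists k, forall m, (k <= m)%N -> I m = I k.

Definition division_ring (T : pzRingType) : Prop :=
  1 <> 0 :> T /\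
  forall x : T, x <> 0 -> exists y, x * y = 1 /\ y * x = 1.

Definition simple_ring (T : pzRingType) : Prop :=
  1 <> 0 :> T /\
  forall I : set T, is_ideal I -> I = [set 0] \/ I = setT.

Definition simple_module (T : pzRingType) (V : lmodType T) : Prop :=
  (exists v : V, v <> 0) /\
  forall W : set V,
    W 0 -> (forall u v, W u -> W v -> W (u + v)) ->
    (forall (t : T) v, W v -> W (t *: v)) ->
    W = [set 0] \/ W = setT.

Definition faithful_module (T : pzRingType) (V : lmodType T) : Prop :=
  forall t : T, (forall v : V, t *: v = 0) -> t = 0.

(* "Primitive" without qualification is left primitive. *)
Definition primitive_ring (T : pzRingType) : Prop :=
  exists V : lmodType T, simple_module V /\ faithful_module V.

Definition ring_iso (A B : pzRingType) : Prop :=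
  exists f : {rmorphism A -> B}, bijective f.

(* None stands for infinity; the supremum of the empty set is Some 0. *)
Definition nat_sup (A : set nat) : option nat :=
  match pselect (exists m, `[< forall k, A k -> (k <= m)%N >]) with
  | left bounded => Some (ex_minn bounded)
  | right _ => None
  end.

(* P 0, ..., P k are the k + 1 members of a chain of length k. *)
Definition prime_chain (T : pzRingType) (k : nat) (P : nat -> set T) : Prop :=
  (forall i, (i <= k)%N -> is_prime_ideal (P i)) /\
  (forall i, (i < k)%N -> P i `<` P i.+1).

Definition krull_dim (T : pzRingType) : option nat :=
  nat_sup [set k | exists P : nat -> set T, prime_chain k P].

Definition height (T : pzRingType) (Q : set T) : option nat :=
  nat_sup [set k | exists P : nat -> set T, prime_chain k P /\ P k = Q].

Definition subring_sort (T : pzRingType) (R : subringClosed T) : Type :=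
  {x : T | x \in R}.

Section SubringSort.
Variables (T : pzRingType) (R : subringClosed T).
HB.instance Definition _ := SubChoice.on (subring_sort R).
HB.instance Definition _ := GRing.SubChoice_isSubPzRing.Build T (mem R)
  (subring_sort R) (GRing.subringClosedP R).
End SubringSort.

Definition maximal_subring (T : pzRingType) (R : subringClosed T) : Prop :=
  [set` R] <> setT /\
  forall A : subringClosed T, {subset R <= A} ->
    [set` A] = [set` R] \/ [set` A] = setT.

(* As R is closed under addition, TxT is contained in R as soon as all the    *)
(* products t * x * s are.                                                    *)
Definition conductor (T : pzRingType) (R : subringClosed T) : set T :=
  [set x | forall t s, t * x * s \in R].
Definition conductor_l (T : pzRingType) (R : subringClosed T) : set T :=
  [set x | forall t, t * x \in R].
Definition conductor_r (T : pzRingType) (R : subringClosed T) : set T :=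
  [set x | forall t, x * t \in R].

Record ideal (T : pzRingType) : Type :=
  Ideal { ideal_set :> set T; idealP : is_ideal ideal_set }.

Definition ideal_pred (T : pzRingType) (I : ideal T) : {pred T} :=
  fun x => `[< ideal_set I x >].

Lemma ideal_pred_closed (T : pzRingType) (I : ideal T) :
  zmod_closed (ideal_pred I).
Proof.
have [I0 IB _ _] := idealP I.
by split=> [|x y /asboolP Ix /asboolP Iy]; apply/asboolP => //; apply: IB.
Qed.

HB.instance Definition _ (T : pzRingType) (I : ideal T) :=
  GRing.isZmodClosed.Build T (ideal_pred I) (ideal_pred_closed I).

(* The library's quotient additive group, which is a quotient ring in the     *)
(* library only when T is commutative.                                        *)
Definition ring_quot (T : pzRingType) (I : ideal T) : Type :=
  Quotient.quot (ideal_pred I).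

Section RingQuot.
Local Open Scope quotient_scope.
Variables (T : pzRingType) (I : ideal T).
Local Notation Q := (ring_quot I).

HB.instance Definition _ := GRing.Zmodule.on Q.
HB.instance Definition _ :=
  EqQuotient.copy Q (Quotient.quot (ideal_pred I)).
HB.instance Definition _ :=
  ZmodQuotient.copy Q (Quotient.quot (ideal_pred I)).

Definition quot_one : Q := \pi_Q 1.
Definition quot_mul (a b : Q) : Q := \pi_Q (repr a * repr b).

Lemma quot_eqP (x y : T) : \pi_Q x = \pi_Q y <-> ideal_set I (x - y).
Proof.
split=> [/eqP|Ixy].
  by rewrite -[_ == _]Quotient.idealrBE => /asboolP.
by apply/eqP; rewrite -[_ == _]Quotient.idealrBE; apply/asboolP.
Qed.

Lemma quot_mulE (x y : T) : quot_mul (\pi_Q x) (\pi_Q y) = \pi_Q (x * y).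
Proof.
have [I0 IB Il Ir] := idealP I.
have ID u v : ideal_set I u -> ideal_set I v -> ideal_set I (u + v).
  by move=> Iu Iv; rewrite -[v]opprK -[- v]sub0r; apply/IB/IB.
apply/quot_eqP; set x' := repr _; set y' := repr _.
have Ix : ideal_set I (x' - x) by apply/quot_eqP; rewrite reprK.
have Iy : ideal_set I (y' - y) by apply/quot_eqP; rewrite reprK.
have -> : x' * y' - x * y = (x' - x) * y' + x * (y' - y).
  by rewrite mulrBl mulrBr addrA subrK.
by apply: ID; [apply: Ir | apply: Il].
Qed.

Lemma quot_mulA : associative quot_mul.
Proof.
move=> a b c; rewrite -[a](@reprK _ Q) -[b](@reprK _ Q) -[c](@reprK _ Q).
by rewrite !quot_mulE mulrA.
Qed.

Lemma quot_mul1l : left_id quot_one quot_mul.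
Proof. by move=> a; rewrite -[a in LHS]reprK quot_mulE mul1r reprK. Qed.

Lemma quot_mul1r : right_id quot_one quot_mul.
Proof. by move=> a; rewrite -[a in LHS]reprK quot_mulE mulr1 reprK. Qed.

Lemma quot_piD (x y : T) : \pi_Q (x + y) = \pi_Q x + \pi_Q y.
Proof. exact: pi_addr. Qed.

Lemma quot_mulDl : left_distributive quot_mul +%R.
Proof.
move=> a b c; rewrite -[a](@reprK _ Q) -[b](@reprK _ Q) -[c](@reprK _ Q).
by rewrite -quot_piD !quot_mulE -quot_piD mulrDl.
Qed.

Lemma quot_mulDr : right_distributive quot_mul +%R.
Proof.
move=> a b c; rewrite -[a](@reprK _ Q) -[b](@reprK _ Q) -[c](@reprK _ Q).
by rewrite -quot_piD !quot_mulE -quot_piD mulrDr.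
Qed.

HB.instance Definition _ := GRing.Zmodule_isPzRing.Build Q
  quot_mulA quot_mul1l quot_mul1r quot_mulDl quot_mulDr.

End RingQuot.

Lemma conductor_is_ideal (T : pzRingType) (R : subringClosed T) :
  is_ideal (conductor R).
Proof.
split=> [t s|x y Rx Ry t s|u x Rx t s|u x Rx t s].
- by rewrite mulr0 mul0r rpred0.
- by rewrite mulrBr mulrBl rpredB.
- by rewrite mulrA Rx.
- by rewrite mulrA -mulrA Rx.
Qed.

Definition conductor_ideal (T : pzRingType) (R : subringClosed T) : ideal T :=
  Ideal (conductor_is_ideal R).

(* Main.v *)
(** Let I be the conductor (R : T). For a in R, the set R + {u | aRu <= I} is a
    subring of T containing R; together with the equality of the three
    conductors, maximality of R then makes R/I a prime ring. Being left Artinian,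
    R/I is simple and contains a full set of matrix units, over which T/I becomes
    M_n(S), where S is the centralizer of the units in T/I, and the part of S
    lying in R/I is a division ring D, maximal in S. A nonzero proper ideal K of
    S meets D trivially, so S = D + K; hence two distinct ones intersect in 0,
    and in that case T inherits the descending chain condition from R through
    the two corresponding ideals of T. An ideal N of T not contained in R
    satisfies R + N = T, so T/N is a quotient of R: this governs the maximal
    ideals of T other than Q. *)
Require Import Defs.
From HB Require Import structures.
From mathcomp Require Import all_boot all_algebra all_classical.

Set Implicit Arguments.
Unset Strict Implicit.
Unset Printing Implicit Defensive.

Import GRing.Theory.
Local Open Scope classical_set_scope.
Local Open Scope card_scope.
Local Open Scope ring_scope.

(** * Ideals, chain conditions and the Jacobson radical *)

(** The one-sided conductors enter in the primeness of R/I: the dichotomies used there can only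
    conclude bT <= R or Tb <= R, which place b in (R:T)_r or (R:T)_l, and the hypothesis brings it
    back to I. As T need not be finitely generated over R, the chain condition passes to T only
    through left ideals that contain an ideal N not inside R: since R + N = T, they are determined
    by their intersection with R. Two such ideals K and L with K ∩ L inside R control a whole chain
    X, through X + L, (X ∩ L) + K and X ∩ R. Matrix units are built explicitly inside R/I, because
    they must coordinatize T/I and R/I at the same time, so that S and D are read off in one
    system. *)

Lemma left_ideal_of_ideal (T : pzRingType) (I : set T) :
  is_ideal I -> is_left_ideal I.
Proof. by case. Qed.

Lemma left_idealN (T : pzRingType) (I : set T) x :
  is_left_ideal I -> I x -> I (- x).
Proof. by move=> [I0 IB _] Ix; rewrite -sub0r; apply: IB. Qed.

Lemma left_idealD (T : pzRingType) (I : set T) x y :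
  is_left_ideal I -> I x -> I y -> I (x + y).
Proof.
move=> Il Ix Iy; rewrite -[y]opprK; case: (Il) => _ IB _.
by apply: IB => //; apply: left_idealN.
Qed.

Lemma left_ideal_sum (T : pzRingType) (I : set T) n (F : 'I_n -> T) :
  is_left_ideal I -> (forall i, I (F i)) -> I (\sum_i F i).
Proof.
move=> Il IF; elim/big_ind: _ => // [|x y Ix Iy]; first by case: Il.
exact: left_idealD.
Qed.

Lemma left_ideal1 (T : pzRingType) (I : set T) :
  is_left_ideal I -> I 1 -> I = setT.
Proof.
move=> [_ _ Im] I1; apply/seteqP; split=> // x _.
by rewrite -[x]mulr1; apply: Im.
Qed.

Lemma left_ideal_principal (T : pzRingType) (x : T) :
  is_left_ideal [set y | exists a, y = a * x].
Proof.
split=> [|y z [a ->] [b ->]|t y [a ->]] /=.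
- by exists 0; rewrite mul0r.
- by exists (a - b); rewrite mulrBl.
- by exists (t * a); rewrite mulrA.
Qed.

Definition ideal_add (T : pzRingType) (I J : set T) : set T :=
  [set x | exists a b, [/\ I a, J b & x = a + b]].

Lemma left_ideal_add (T : pzRingType) (I J : set T) :
  is_left_ideal I -> is_left_ideal J -> is_left_ideal (ideal_add I J).
Proof.
move=> [I0 IB Im] [J0 JB Jm]; split.
- by exists 0, 0; rewrite addr0.
- move=> _ _ [a [b [Ia Jb ->]]] [c [d [Ic Jd ->]]].
  exists (a - c), (b - d); split; [exact: IB|exact: JB|].
  by rewrite opprD addrACA.
- move=> t _ [a [b [Ia Jb ->]]]; exists (t * a), (t * b).
  by split; [exact: Im|exact: Jm|rewrite mulrDr].
Qed.

Lemma ideal_of_add (T : pzRingType) (I J : set T) :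
  is_ideal I -> is_ideal J -> is_ideal (ideal_add I J).
Proof.
move=> Ii Ji; have [A0 AB Am] :=
  left_ideal_add (left_ideal_of_ideal Ii) (left_ideal_of_ideal Ji).
split=> // t _ [a [b [Ia Jb ->]]]; exists (a * t), (b * t).
case: Ii Ji => [_ _ _ Im] [_ _ _ Jm].
by split; [exact: Im|exact: Jm|rewrite mulrDl].
Qed.

Lemma left_ideal_cap (T : pzRingType) (I J : set T) :
  is_left_ideal I -> is_left_ideal J -> is_left_ideal (I `&` J).
Proof.
move=> [I0 IB Im] [J0 JB Jm]; split=> // [x y [Ix Jx] [Iy Jy]|t x [Ix Jx]].
- by split; [exact: IB|exact: JB].
- by split; [exact: Im|exact: Jm].
Qed.

Lemma ideal_cap (T : pzRingType) (I J : set T) :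
  is_ideal I -> is_ideal J -> is_ideal (I `&` J).
Proof.
move=> Ii Ji; have [A0 AB Am] :=
  left_ideal_cap (left_ideal_of_ideal Ii) (left_ideal_of_ideal Ji).
split=> // t x [Ix Jx]; case: Ii Ji => [_ _ _ Im] [_ _ _ Jm].
by split; [exact: Im|exact: Jm].
Qed.

Lemma ideal_addl (T : pzRingType) (I J : set T) :
  is_left_ideal J -> I `<=` ideal_add I J.
Proof. by move=> [J0 _ _] x Ix; exists x, 0; rewrite addr0. Qed.

Lemma ideal_addr (T : pzRingType) (I J : set T) :
  is_left_ideal I -> J `<=` ideal_add I J.
Proof. by move=> [I0 _ _] x Jx; exists 0, x; rewrite add0r. Qed.

Lemma ideal_zero (T : pzRingType) : is_ideal [set 0 : T].
Proof.
by split=> [//|x y /= -> ->|t x /= ->|t x /= ->]; rewrite (subr0, mulr0, mul0r).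
Qed.

Lemma is_ideal_mul (T : pzRingType) (I J : set T) :
  is_ideal I -> is_ideal J -> is_ideal (ideal_mul I J).
Proof.
move=> [I0 IB Il Ir] [J0 JB Jl Jr]; split.
- by exists 0%N, (fun=> 0), (fun=> 0); split=> //; rewrite big_ord0.
- move=> _ _ [n [a [b [Ia Jb ->]]]] [m [c [d [Ic Jd ->]]]].
  (* A difference of two finite sums is the concatenated sum; the sign is carried by the left
     factors of the second one. *)
  exists (n + m)%N,
    (fun i : 'I_(n + m) =>
       match fintype.split i with inl i => a i | inr i => - c i end),
    (fun i : 'I_(n + m) =>
       match fintype.split i with inl i => b i | inr i => d i end); split.
  + by move=> i; case: (fintype.split i) => // j; rewrite -sub0r; apply: IB.
  + by move=> i; case: (fintype.split i).
  + rewrite big_split_ord /= -sumrN; congr (_ + _); apply: eq_bigr => i _.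
      by rewrite (unsplitK (inl i)).
    by rewrite (unsplitK (inr i)) mulNr.
- move=> t _ [n [a [b [Ia Jb ->]]]]; exists n, (fun i => t * a i), b.
  split=> // [i|]; first exact: Il.
  by rewrite mulr_sumr; apply: eq_bigr => i _; rewrite mulrA.
- move=> t _ [n [a [b [Ia Jb ->]]]]; exists n, a, (fun i => b i * t).
  split=> // [i|]; first exact: Jr.
  by rewrite mulr_suml; apply: eq_bigr => i _; rewrite mulrA.
Qed.

Lemma ideal_mulI (T : pzRingType) (I J : set T) x y :
  I x -> J y -> ideal_mul I J (x * y).
Proof.
move=> Ix Jy; exists 1%N, (fun=> x), (fun=> y).
by split=> //; rewrite big_ord1.
Qed.

Lemma ideal_mul_subl (T : pzRingType) (I J : set T) :
  is_ideal I -> ideal_mul I J `<=` I.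
Proof.
move=> Ii _ [n [a [b [Ia _ ->]]]]; apply: left_ideal_sum => [|i].
  exact: left_ideal_of_ideal.
by case: Ii => [_ _ _]; apply.
Qed.

(** Without a minimal member, choice yields a strictly descending sequence inside the family. *)
Lemma artinian_min (T : pzRingType) (F : set (set T)) :
  left_artinian T -> (forall I, F I -> is_left_ideal I) -> (exists I, F I) ->
  exists2 I, F I & forall J, F J -> J `<=` I -> J = I.
Proof.
move=> art Fl [I0 FI0]; apply: contrapT => nomin.
have next I : F I -> exists2 J, F J & J `<` I.
  move=> FI; apply: contrapT => no; apply: nomin; exists I => // J FJ JI.
  apply: contrapT => JneI; apply: no; exists J => //; split=> // IJ.
  by apply: JneI; apply/seteqP.
(* Stated as an implication so that [f] is total; outside [F] its value is a dummy. *)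
have /boolp.choice[f fP] I : exists J, F I -> F J /\ J `<` I.
  have [/next[J FJ JI]|nFI] := pselect (F I); first by exists J.
  by exists I.
have FC k : F (iter k f I0) by elim: k => //= k /fP[].
have [k kP] := art (fun k => iter k f I0) (fun k => Fl _ (FC k))
  (fun k => properW (fP _ (FC k)).2).
by have := (fP _ (FC k)).2; rewrite -[f _]/(iter k.+1 f I0) kP // => /properxx.
Qed.

(** Chains are pulled back along [f], and surjectivity recovers each member from its preimage. Plain
    functions are allowed, so that the lemma applies to composites such as the projection restricted
    to a subring. *)
Lemma left_artinian_surj (A B : pzRingType) (f : A -> B) :
  (forall x y, f (x - y) = f x - f y) -> (forall x y, f (x * y) = f x * f y) ->
  (forall b, exists a, f a = b) -> left_artinian A -> left_artinian B.
Proof.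
move=> fB fM fS art I Il dI.
have f0 : f 0 = 0 by rewrite -[X in f X](subrr 0) fB subrr.
have [|n a nP|k kP] := art (fun n => f @^-1` I n).
- move=> n; case: (Il n) => I0 IB Im; split=> /= [|x y|t x].
  + by rewrite f0.
  + by rewrite fB; apply: IB.
  + by rewrite fM; apply: Im.
- exact: dI.
exists k => m /kP e; apply/seteqP; split=> b; have [a <-] := fS b.
- by move=> Ia; have : (f @^-1` I m) a by []; rewrite e.
- by move=> Ia; have : (f @^-1` I k) a by []; rewrite -e.
Qed.

Lemma exists_maximal_left_ideal (T : pzRingType) (L : set T) :
  is_left_ideal L -> ~ L 1 -> exists2 M, is_maximal_left_ideal M & L `<=` M.
Proof.
move=> Ll L1.
(* The family contains the empty set because [Zorn_bigcup] also asks for the *)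
(* union of the empty chain.                                                *)
pose P (X : set T) := is_left_ideal (L `|` X) /\ ~ (L `|` X) 1.
have [F FP tot|X [[Xl X1] Xmax]] := @Zorn_bigcup T P.
  have LU X x : F X -> (L `|` X) x -> (L `|` \bigcup_(Y in F) Y) x.
    by move=> FX [Lx|Xx]; [left|right; exists X].
  (* Totality puts two elements of the union into one member of the chain; the first alternative
     also covers the empty chain. *)
  have common x y : (L `|` \bigcup_(X in F) X) x ->
      (L `|` \bigcup_(X in F) X) y ->
      (L x /\ L y) \/ exists X, [/\ F X, (L `|` X) x & (L `|` X) y].
    move=> [Lx|[X FX Xx]] [Ly|[Y FY Yy]].
    - by left.
    - by right; exists Y; split=> //; [left|right].
    - by right; exists X; split=> //; [right|left].
    - right; have [XY|YX] := tot _ _ FX FY.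
        by exists Y; split=> //; right=> //; apply: XY.
      by exists X; split=> //; right=> //; apply: YX.
  case: (Ll) => L0 LB Lm; split; last first.
    move=> U1; have [[]|[X [/FP[_ X1] UX _]]] // := common _ _ U1 U1.
  split=> [|x y Ux Uy|t x Ux]; first by left.
    have [[Lx Ly]|[X [FX Xx Xy]]] := common _ _ Ux Uy; first by left; apply: LB.
    by apply: (LU X) => //; have [[_ XB _] _] := FP _ FX; apply: XB.
  have [[Lx _]|[X [FX Xx _]]] := common _ _ Ux Ux; first by left; apply: Lm.
  by apply: (LU X) => //; have [[_ _ Xm] _] := FP _ FX; apply: Xm.
exists (L `|` X); last by move=> x; left.
split=> // [eT|I Il LXI]; first by apply: X1; rewrite eT.
have [I1|nI1] := pselect (I 1); first by right; apply: left_ideal1.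
left; apply: contrapT => IneX.
have LI : L `|` I = I by apply/setUidPr => x Lx; apply: LXI; left.
apply: (Xmax I); last by rewrite /P LI.
split=> [x Xx|IX]; first by apply: LXI; right.
by apply: IneX; apply/seteqP; split=> // x /IX; right.
Qed.

(** If [1 - r * x] has no left inverse, it lies in a maximal left ideal, which also contains [x] and
    hence 1. Conversely, a maximal left ideal [M] missing [x] gives [1 = m + r * x] with [m] in [M]
    left invertible. *)
Lemma jacobsonP (T : pzRingType) (x : T) :
  jacobson T x <-> forall r, exists u, u * (1 - r * x) = 1.
Proof.
split=> [Jx r|linv M [[M0 MB Mm] MneT Mmax]].
  apply: contrapT => nu.
  have [|M Mmax LM] :=
      exists_maximal_left_ideal (left_ideal_principal (1 - r * x)).
    by move=> [u eu]; apply: nu; exists u.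
  have [Ml MneT _] := Mmax; apply: MneT; apply: left_ideal1 => //.
  rewrite -[1](subrK (r * x)); apply: left_idealD => //.
    by apply: LM; exists 1; rewrite mul1r.
  by case: Ml => _ _; apply; apply: Jx.
have Ml : is_left_ideal M by [].
have Xl := left_ideal_principal x.
apply: contrapT => nMx.
have [e|e] := Mmax _ (left_ideal_add Ml Xl) (@ideal_addl _ _ _ Xl).
  apply: nMx; rewrite -e; apply: (@ideal_addr _ _ _ Ml).
  by exists 1; rewrite mul1r.
have : ideal_add M [set y | exists a, y = a * x] 1 by rewrite e.
move=> [m [_ [Mm' [r ->] e1]]]; apply: MneT; apply: left_ideal1 => //.
have [u <-] := linv r; apply: Mm.
by rewrite e1 addrK.
Qed.

Lemma jacobson_ideal (T : pzRingType) : is_ideal (jacobson T).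
Proof.
split=> [M [[M0 _ _] _ _]//|x y Jx Jy M Mmax|t x Jx M Mmax|s x /jacobsonP Jx].
- by have [[_ MB _] _ _] := Mmax; apply: MB; [apply: Jx|apply: Jy].
- by have [[_ _ Mm] _ _] := Mmax; apply: Mm; apply: Jx.
apply/jacobsonP => r; have [u eu] := Jx (s * r).
(* The usual passage from an inverse [u] of [1 - b * a] to the inverse [1 + a * u * b] of
   [1 - a * b], with [a = r * x] and [b = s]. *)
exists (1 + r * x * u * s).
have -> : (1 + r * x * u * s) * (1 - r * (x * s)) =
    1 - r * x * s + r * x * (u * (1 - s * r * x)) * s.
  rewrite mulrDl mul1r !mulrA; congr (_ + _).
  by rewrite !mulrBr !mulrBl !mulr1 !mulrA.
by rewrite eu mulr1 subrK.
Qed.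

Lemma jacobson_proper (T : pzRingType) :
  1 <> 0 :> T -> ~ jacobson T 1.
Proof.
move=> T1 /jacobsonP/(_ 1)[u]; rewrite mulr1 subrr mulr0 => e.
exact: T1.
Qed.

(** An ideal above the kernel is saturated ([fI]), so it is determined by its image, which is an
    ideal of [B] by surjectivity. *)
Lemma ker_maximal (A B : pzRingType) (f : A -> B) :
  (forall x y, f (x - y) = f x - f y) -> (forall x y, f (x * y) = f x * f y) ->
  (forall b, exists a, f a = b) -> simple_ring B ->
  is_maximal_ideal [set x | f x = 0].
Proof.
move=> fB fM fS [B1 Bs].
have f0 : f 0 = 0 by rewrite -[X in f X](subrr 0) fB subrr.
split=> [|eT|I [I0 IB Il Ir] KI].
- split=> [//|x y /= fx fy|t x /= fx|t x /= fx].
  + by rewrite fB fx fy subrr.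
  + by rewrite fM fx mulr0.
  + by rewrite fM fx mul0r.
- have [a fa] := fS 1; apply: B1; rewrite -fa.
  by have : [set x | f x = 0] a by rewrite eT.
have fI x y : I x -> f x = f y -> I y.
  move=> Ix e; rewrite -(subKr x y); apply: IB => //; apply: KI => /=.
  by rewrite fB e subrr.
have [|e|e] := Bs (f @` I).
- split=> [|_ _ [x Ix <-] [y Iy <-]|t _ [x Ix <-]|t _ [x Ix <-]].
  + by exists 0.
  + by exists (x - y) => //; apply: IB.
  + by have [a <-] := fS t; exists (a * x) => //; apply: Il.
  + by have [a <-] := fS t; exists (x * a) => //; apply: Ir.
- left; apply/seteqP; split=> // x Ix /=.
  have : (f @` I) (f x) by exists x.
  by rewrite e.
- right; apply/seteqP; split=> // x _.
  have : (f @` I) (f x) by rewrite e.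
  by move=> [y Iy /esym] /esym; apply: fI.
Qed.

(** * Prime left Artinian rings *)

Definition prime_ring (A : pzRingType) : Prop :=
  1 <> 0 :> A /\
  forall a b : A, (forall x, a * x * b = 0) -> a = 0 \/ b = 0.

Lemma prime_neq0 (A : pzRingType) (a b : A) :
  prime_ring A -> a <> 0 -> b <> 0 -> exists x, a * x * b <> 0.
Proof.
move=> [_ pA] a0 b0; apply: contrapT => no.
by have [x||] := pA a b => //; apply: contrapT => abx; apply: no; exists x.
Qed.

(** This says that the corner ring [eAe] is a division ring. It is written with equations in [A]
    because the identity of the corner is [e], not 1. *)
Definition division_idempotent (A : pzRingType) (e : A) : Prop :=
  [/\ e <> 0, e * e = e &
      forall x, e * x * e = x -> x <> 0 ->
        exists y, [/\ e * y * e = y, x * y = e & y * x = e]].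

(* Brauer's lemma *)
Lemma prime_artinian_idempotent (A : pzRingType) :
  prime_ring A -> left_artinian A -> exists e : A, division_idempotent e.
Proof.
move=> pA art; have [A1 _] := pA.
have [||L [Ll [l [Ll' l0]]] Lmin] := @artinian_min A
  [set I | is_left_ideal I /\ exists x, I x /\ x <> 0] art.
- by move=> I [].
- exists setT; split=> //; by exists 1.
have {}Lmin I : is_left_ideal I -> (exists x, I x /\ x <> 0) -> I `<=` L -> I = L.
  by move=> *; apply: Lmin.
have [L0 LB Lm] := Ll.
(* Primeness gives [l * x * l <> 0], so [a := x * l] lies in [L] and [L a] is nonzero; minimality
   then gives [L a = L]. *)
have [x lxl] := prime_neq0 pA l0 l0; rewrite -mulrA in lxl.
have La : L (x * l) by apply: Lm.
move: (x * l) La lxl => a La la0.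
have a0 : a <> 0 by move=> a0; apply: la0; rewrite a0 mulr0.
have eLa : [set y | exists2 b, L b & y = b * a] = L.
  apply: Lmin => [|| _ [b _ ->]]; last exact: Lm.
    split=> [|_ _ [b Lb ->] [c Lc ->]|t _ [b Lb ->]].
    - by exists 0; rewrite ?mul0r.
    - by exists (b - c); rewrite ?mulrBl//; apply: LB.
    - by exists (t * b); rewrite ?mulrA//; apply: Lm.
  by exists (l * a); split=> //; exists l.
(* The annihilator of [a] in [L] is a left ideal that misses [l], so by minimality it vanishes. *)
have ann y : L y -> y * a = 0 -> y = 0.
  move=> Ly ya; apply: contrapT => y0.
  have e : L `&` [set z | z * a = 0] = L.
    apply: Lmin => [||z []//]; last by exists y.
    apply: left_ideal_cap => //; split=> [|z w /= za wa|t z /= za] /=.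
    - by rewrite mul0r.
    - by rewrite mulrBl za wa subrr.
    - by rewrite -mulrA za mulr0.
  by apply: la0; have [] : (L `&` [set z | z * a = 0]) l by rewrite e.
(* From [e * a = a], the element [e * e - e] of [L] annihilates [a], so [e] is idempotent. *)
have [e Le ea] : exists2 e, L e & a = e * a.
  by have : L a by []; rewrite -{1}eLa => -[e]; exists e.
have ee : e * e = e.
  apply/eqP; rewrite -subr_eq0; apply/eqP/ann.
    by apply: LB => //; apply: Lm.
  by rewrite mulrBl -mulrA -!ea subrr.
(* A nonzero [z] of [eAe] lies in [L], so [A z = L] contains [e]. *)
have linv z : e * z * e = z -> z <> 0 -> exists2 y, e * y * e = y & y * z = e.
  move=> ez z0.
  have Lz : L z by rewrite -ez; apply: Lm.
  have eL : [set y | exists b, y = b * z] = L.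
    apply: Lmin; first exact: left_ideal_principal.
      by exists z; split=> //; exists 1; rewrite mul1r.
    by move=> _ [b ->]; apply: Lm.
  have [b eb] : exists b, e = b * z by have : L e by []; rewrite -{1}eL.
  exists (e * b * e); first by rewrite !mulrA ee -!mulrA ee.
  have eze : e * z = z by rewrite -ez !mulrA ee.
  by rewrite -!mulrA eze -eb ee.
exists e; split=> //.
  by move=> e0; apply: a0; rewrite ea e0 mul0r.
move=> z ez z0; have [y ey yz] := linv _ ez z0.
have e0 : e <> 0 by move=> e0; apply: a0; rewrite ea e0 mul0r.
(* Left inverses are enough: the left inverse [w] of [y] equals [w * (y * z) = z]. *)
have y0 : y <> 0 by move=> y0; apply: e0; rewrite -yz y0 mul0r.
have [w ew wy] := linv _ ey y0.
exists y; split=> //.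
have eze : e * z = z by rewrite -ez !mulrA ee.
have wew : w * e = w by rewrite -ew -!mulrA ee.
by have <- : w = z by rewrite -wew -yz mulrA wy eze.
Qed.

(** The products [u i * v j] are matrix units. Keeping them factored through [e] lets
    [centralizer_division] compare their centralizer with the corner [eAe]. *)
Definition rank_one_units (A : pzRingType) (e : A) n (u v : 'I_n -> A) : Prop :=
  [/\ forall i, u i * e = u i, forall i, e * v i = v i &
      forall i j, v i * u j = if i == j then e else 0].

(** Choose a family for which the left ideal generated by [1 - \sum_i u i * v i] is minimal. If this
    idempotent [g] is nonzero, primeness finds a further pair [u0], [v0] in [gAe] and [eAg],
    orthogonal to the old ones, which makes the left ideal strictly smaller. *)
Lemma prime_artinian_units (A : pzRingType) (e : A) :
  prime_ring A -> left_artinian A -> division_idempotent e ->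
  exists n (u v : 'I_n -> A),
    [/\ (0 < n)%N, rank_one_units e u v & \sum_i u i * v i = 1].
Proof.
move=> pA art [e0 ee einv]; have [A1 _] := pA.
pose F (I : set A) := exists n (u v : 'I_n -> A),
  rank_one_units e u v /\ I = [set y | exists a, y = a * (1 - \sum_i u i * v i)].
have [|| _ [n [u [v [uv ->]]]] min] := @artinian_min A F art.
- by move=> _ [n [u [v [_ ->]]]]; apply: left_ideal_principal.
(* The empty family shows that [F] is inhabited, with left ideal all of [A]. *)
- eexists; exists 0%N, (fun=> 0), (fun=> 0); split; last reflexivity.
  by split=> -[].
pose f := \sum_i u i * v i; pose g := 1 - f.
have [ue ev vu] := uv.
have fu j : f * u j = u j.
  rewrite mulr_suml (bigD1 j)//= -mulrA vu eqxx ue big1 ?addr0// => i ij.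
  by rewrite -mulrA vu (negPf ij) mulr0.
have vf j : v j * f = v j.
  rewrite mulr_sumr (bigD1 j)//= mulrA vu eqxx ev big1 ?addr0// => i ij.
  by rewrite mulrA vu eq_sym (negPf ij) mul0r.
have gu j : g * u j = 0 by rewrite mulrBl mul1r fu subrr.
have vg j : v j * g = 0 by rewrite mulrBr mulr1 vf subrr.
have gg : g * g = g.
  rewrite {2}/g mulrBr mulr1 mulr_sumr big1 ?subr0// => i _.
  by rewrite mulrA gu mul0r.
suff f1 : f = 1.
  exists n, u, v; split=> //.
  (* The family is not empty, since otherwise [f = 1] would read 0 = 1. *)
  case: n u v {min uv ue ev vu fu vf gu vg g gg} @f f1 => // u v /=.
  by rewrite big_ord0 => /esym.
apply: contrapT => f1.
have g0 : g <> 0 by move=> /eqP; rewrite subr_eq0 => /eqP /esym.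
(* Primeness twice: first [u0 = g * a * e] is nonzero, then so is [e * b * u0] in [eAe]; its inverse
   [y] normalizes [v0] so that [v0 * u0 = e]. *)
have [a u00] := prime_neq0 pA g0 e0; set u0 := g * a * e in u00.
have [b z0] := prime_neq0 pA e0 u00.
have [|y [ey _ yz]] := einv _ _ z0; first by rewrite /u0 !mulrA ee -!mulrA ee.
have ey1 : e * y = y by rewrite -ey !mulrA ee.
pose v0 := y * e * b * g.
have gu0 : g * u0 = u0 by rewrite /u0 !mulrA gg.
have v0g : v0 * g = v0 by rewrite -mulrA gg.
have v0u0 : v0 * u0 = e by rewrite -yz /v0 -!mulrA gu0.
pose u' (i : 'I_n.+1) := if unlift ord0 i is Some j then u j else u0.
pose v' (i : 'I_n.+1) := if unlift ord0 i is Some j then v j else v0.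
have uv' : rank_one_units e u' v'.
  split=> [i|i|i j]; rewrite /u' /v'.
  - by case: unliftP => [k _|_] //; rewrite /u0 -!mulrA ee.
  - by case: unliftP => [k _|_] //; rewrite /v0 !mulrA ey1.
  - case: unliftP => [k ->|->]; case: unliftP => [l ->|->] //.
    + by rewrite -gu0 mulrA vg mul0r.
    + by rewrite -v0g -mulrA gu mulr0.
have g' : 1 - \sum_i u' i * v' i = g - u0 * v0.
  rewrite big_ord_recl /u' /v' unlift_none (addrC (u0 * v0)) opprD addrA.
  by congr (1 - _ - _); apply: eq_bigr => i _; rewrite liftK.
(* By minimality [g = c * (g - u0 * v0)]. Multiplied by [u0] on the right, the left side is [u0] and
   the right side vanishes. *)
have : [set y | exists a, y = a * (1 - \sum_i u' i * v' i)] g.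
  have -> := min [set y | exists a, y = a * (1 - \sum_i u' i * v' i)].
  - by exists 1; rewrite mul1r.
  - by exists n.+1, u', v'.
  - move=> _ [c ->]; exists (c * (g - u0 * v0)).
    by rewrite g' -mulrA -/f -/g mulrBl gg -mulrA v0g.
move=> [c]; rewrite g' => ec; apply: u00.
by rewrite -gu0 ec -mulrA mulrBl gu0 -mulrA v0u0 /u0 -!mulrA ee subrr mulr0.
Qed.

(** Primeness brings a nonzero element [k] of an ideal into the corner as a nonzero
    [e * a * k * b * e], invertible there. So the ideal contains [e], then every [u i * e * v i],
    and their sum 1. *)
Lemma prime_artinian_simple (A : pzRingType) :
  prime_ring A -> left_artinian A -> simple_ring A.
Proof.
move=> pA art; have [A1 _] := pA.
have [e edi] := prime_artinian_idempotent pA art.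
have [n [u [v [_ [ue _ _] uv1]]]] := prime_artinian_units pA art edi.
have [e0 ee einv] := edi.
split=> // K Ki; have [K0 _ Kl Kr] := Ki.
have [|nK0] := pselect (K `<=` [set 0]).
  by move=> K0'; left; apply/seteqP; split=> // _ ->.
right; apply: left_ideal1; first exact: left_ideal_of_ideal.
have [k [Kk k0]] : exists k, K k /\ k <> 0.
  apply: contrapT => no; apply: nK0 => k Kk /=.
  by apply: contrapT => k0; apply: no; exists k.
have [a eak] := prime_neq0 pA e0 k0.
have [b eakbe] := prime_neq0 pA eak e0.
have [|y [_ _ yz]] := einv _ _ eakbe; first by rewrite !mulrA ee -!mulrA ee.
have Ke : K e by rewrite -yz; apply: (Kl); apply: (Kr); apply: (Kr); apply: Kl.
rewrite -uv1; apply: left_ideal_sum => [|i]; first exact: left_ideal_of_ideal.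
by rewrite -ue; apply: (Kr); apply: (Kl).
Qed.

(** * Subrings and quotient rings *)

(** Subrings as plain sets, so that maximality can be applied to comprehensions such as R + N. *)
Definition subring_set (T : pzRingType) (P : set T) : Prop :=
  [/\ P 1, forall x y, P x -> P y -> P (x - y) &
      forall x y, P x -> P y -> P (x * y)].

Section SubringOfSet.
Variables (T : pzRingType) (P : set T) (Psub : subring_set P).

Definition subring_of_set_pred : {pred T} := fun x => `[< P x >].

Lemma subring_of_set_closed : subring_closed subring_of_set_pred.
Proof.
have [P1 PB PM] := Psub; split=> [|x y|x y]; first exact/asboolP.
  by move=> /asboolP Px /asboolP Py; apply/asboolP; apply: PB.
by move=> /asboolP Px /asboolP Py; apply/asboolP; apply: PM.
Qed.

HB.instance Definition _ :=
  GRing.isSubringClosed.Build T subring_of_set_pred subring_of_set_closed.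

Definition subring_of_set : subringClosed T := subring_of_set_pred.

Lemma mem_subring_of_set x : x \in subring_of_set <-> P x.
Proof. by split=> /asboolP. Qed.

End SubringOfSet.

Lemma maximal_subring_set (T : pzRingType) (R : subringClosed T) (P : set T) :
  maximal_subring R -> subring_set P -> [set` R] `<=` P ->
  P = [set` R] \/ P = setT.
Proof.
move=> [_ Rmax] Psub RP.
have e : [set` subring_of_set Psub] = P.
  by apply/seteqP; split=> x; have [] := mem_subring_of_set Psub x.
rewrite -e; apply: Rmax => x Rx.
by have [_] := mem_subring_of_set Psub x; apply; apply: RP.
Qed.

Section Quotient.
Local Open Scope quotient_scope.
Variables (T : pzRingType) (I : ideal T).

Definition quot_proj (x : T) : ring_quot I := \pi_(ring_quot I) x.

Lemma quot_projB x y : quot_proj (x - y) = quot_proj x - quot_proj y.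
Proof.
by apply: (@addIr _ (quot_proj y)); rewrite subrK -[LHS]quot_piD subrK.
Qed.

Lemma quot_projM x y : quot_proj (x * y) = quot_proj x * quot_proj y.
Proof. exact/esym/quot_mulE. Qed.

Lemma quot_proj1 : quot_proj 1 = 1.
Proof. by []. Qed.

Lemma quot_proj_surj b : exists x, quot_proj x = b.
Proof. by exists (repr b); rewrite /quot_proj reprK. Qed.

Lemma quot_proj_eq x y : quot_proj x = quot_proj y <-> ideal_set I (x - y).
Proof. exact: quot_eqP. Qed.

Lemma quot_proj0 : quot_proj 0 = 0.
Proof. by rewrite -[X in quot_proj X](subrr 0) quot_projB subrr. Qed.

Lemma quot_proj_eq0 x : quot_proj x = 0 <-> ideal_set I x.
Proof. by rewrite -quot_proj0 quot_proj_eq subr0. Qed.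

End Quotient.

(** [I] and [J] are ideals built so that their product lies in [P], while [a] is in [I] by
    hypothesis and [b] is in [J] by definition of [I]. *)
Lemma prime_idealP (T : pzRingType) (P : set T) a b :
  is_prime_ideal P -> (forall t, P (a * t * b)) -> P a \/ P b.
Proof.
move=> [[P0 PB Pl Pr] _ Pp] aPb.
pose I := [set x | forall t, P (x * t * b)].
pose J := [set y | forall x t, I x -> P (x * t * y)].
have [||||] := Pp I J.
- split=> [t|x y Ix Iy t|s x Ix t|s x Ix t].
  + by rewrite !mul0r.
  + by rewrite !mulrBl; apply: PB; [apply: Ix|apply: Iy].
  + by rewrite -!mulrA; apply: Pl; rewrite mulrA; apply: Ix.
  + by rewrite -(mulrA x); apply: Ix.
- split=> [x t _|y z Jy Jz x t Ix|s y Jy x t Ix|s y Jy x t Ix].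
  + by rewrite mulr0.
  + by rewrite mulrBr; apply: PB; [apply: Jy|apply: Jz].
  + by rewrite mulrA -(mulrA x); apply: Jy.
  + by rewrite mulrA; apply: Pr; apply: Jy.
- move=> _ [n [x [y [Ix Jy ->]]]]; apply: left_ideal_sum => // i.
  by rewrite -[x i]mulr1; apply: Jy.
- by move=> IP; left; apply: IP.
- by move=> JP; right; apply: JP => x t; apply.
Qed.

Lemma prime_quotient (T : pzRingType) (I : ideal T) :
  is_prime_ideal I -> prime_ring (ring_quot I).
Proof.
move=> Ip; have [Ii IneT _] := Ip; split=> [|a b].
  rewrite -quot_proj1 => /quot_proj_eq0 I1; apply: IneT.
  exact: (left_ideal1 (left_ideal_of_ideal Ii)).
have [x <-] := quot_proj_surj a; have [y <-] := quot_proj_surj b.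
move=> ab0; rewrite !quot_proj_eq0; apply: prime_idealP => // t.
by apply/quot_proj_eq0; rewrite !quot_projM.
Qed.

(** If neither factor lies in [M], then [1 = m + i = m' + j], and expanding the product puts 1 into
    [M]. *)
Lemma maximal_ideal_prime (T : pzRingType) (M : set T) :
  is_maximal_ideal M -> is_prime_ideal M.
Proof.
move=> [Mi MneT Mmax]; split=> // I J Ii Ji IJM.
have Ml := left_ideal_of_ideal Mi.
have [Il Jl] := (left_ideal_of_ideal Ii, left_ideal_of_ideal Ji).
have [|nIM] := pselect (I `<=` M); first by left.
have [|nJM] := pselect (J `<=` M); first by right.
exfalso; apply: MneT; apply: left_ideal1 => //.
have addT K : is_ideal K -> ~ K `<=` M -> exists m k, [/\ M m, K k & 1 = m + k].
  move=> Ki nKM; have Kl := left_ideal_of_ideal Ki.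
  have [e|e] := Mmax _ (ideal_of_add Mi Ki) (@ideal_addl _ _ _ Kl).
    by case: nKM; rewrite -e; apply: ideal_addr.
  have : ideal_add M K 1 by rewrite e.
  by move=> [m [k []]]; exists m, k.
have [m [i [Mm Ii' e1]]] := addT _ Ii nIM.
have [m' [j [Mm' Jj e1']]] := addT _ Ji nJM.
have [_ _ Mtl Mtr] := Mi.
rewrite -[1]mulr1 {1}e1 mulrDl; apply: left_idealD => //; first exact: Mtr.
rewrite e1' mulrDr; apply: left_idealD => //; first exact: Mtl.
by apply: IJM; apply: ideal_mulI.
Qed.

(** * Matrix units *)

Section MatrixUnits.
Variables (B : pzRingType) (R : subringClosed B) (n : nat).
Variable E : 'I_n -> 'I_n -> B.
Hypothesis ER : forall i j, E i j \in R.
Hypothesis EM : forall i j k l, E i j * E k l = if j == k then E i l else 0.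
Hypothesis E1 : \sum_i E i i = 1.

Lemma centralizer_subring :
  subring_set [set b : B | forall i j, b * E i j = E i j * b].
Proof.
split=> [i j|x y xE yE i j|x y xE yE i j]; first by rewrite mul1r mulr1.
  by rewrite mulrBl mulrBr xE yE.
by rewrite -mulrA yE mulrA xE mulrA.
Qed.

Definition matrix_centralizer : pzRingType :=
  subring_sort (subring_of_set centralizer_subring).

Lemma centralizerP (s : matrix_centralizer) i j :
  val s * E i j = E i j * val s.
Proof. by have /mem_subring_of_set := valP s; apply. Qed.

(** The (i, j) coefficient of [b], copied to all diagonal positions so that it commutes with the
    matrix units. *)
Definition entry_val (b : B) i j : B := \sum_k E k i * b * E j k.

Lemma unit_entry_val b i j p q : E p q * entry_val b i j = E p i * b * E j q.
Proof.
rewrite mulr_sumr (bigD1 q)//= big1 ?addr0 => [|k kq]; last first.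
  by rewrite !mulrA EM eq_sym (negPf kq) !mul0r.
by rewrite !mulrA EM eqxx.
Qed.

Lemma entry_val_unit b i j p q : entry_val b i j * E p q = E p i * b * E j q.
Proof.
rewrite mulr_suml (bigD1 p)//= big1 ?addr0 => [|k kp]; last first.
  by rewrite -!mulrA EM (negPf kp) !mulr0.
by rewrite -!mulrA EM eqxx.
Qed.

Lemma entry_subproof b i j :
  entry_val b i j \in subring_of_set centralizer_subring.
Proof.
apply/mem_subring_of_set => p q.
by rewrite entry_val_unit unit_entry_val.
Qed.

Definition entry (b : B) i j : matrix_centralizer :=
  Sub (entry_val b i j) (entry_subproof b i j).

Definition to_matrix (b : B) : 'M[matrix_centralizer]_n :=
  \matrix_(i, j) entry b i j.

Definition of_matrix (M : 'M[matrix_centralizer]_n) : B :=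
  \sum_i \sum_j val (M i j) * E i j.

Lemma to_matrixK : cancel to_matrix of_matrix.
Proof.
move=> b; rewrite /of_matrix.
transitivity (\sum_i \sum_j E i i * b * E j j).
  apply: eq_bigr => i _; apply: eq_bigr => j _.
  by rewrite mxE SubK entry_val_unit.
under eq_bigr => i _ do rewrite -mulr_sumr E1 mulr1.
by rewrite -mulr_suml E1 mul1r.
Qed.

Lemma of_matrixK : cancel of_matrix to_matrix.
Proof.
move=> M; apply/matrixP => i j; apply: val_inj; rewrite mxE SubK /entry_val.
transitivity (\sum_k val (M i j) * E k k); last by rewrite -mulr_sumr E1 mulr1.
apply: eq_bigr => k _; rewrite /of_matrix mulr_sumr mulr_suml.
rewrite (bigD1 i)//= [X in _ + X]big1 ?addr0 => [|p pi]; last first.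
  rewrite mulr_sumr mulr_suml big1 // => q _.
  by rewrite centralizerP !mulrA EM eq_sym (negPf pi) !mul0r.
rewrite mulr_sumr mulr_suml (bigD1 j)//= [X in _ + X]big1 ?addr0 => [|q qj].
  by rewrite mulrA -centralizerP -!mulrA EM eqxx EM eqxx.
by rewrite -!mulrA EM (negPf qj) !mulr0.
Qed.

Lemma to_matrix_bij : bijective to_matrix.
Proof. exact: Bijective to_matrixK of_matrixK. Qed.

Lemma to_matrix_is_zmod_morphism : zmod_morphism to_matrix.
Proof.
move=> a b; apply/matrixP => i j; apply: val_inj.
rewrite !mxE raddfB /= -sumrB; apply: eq_bigr => k _.
by rewrite mulrBr mulrBl.
Qed.

Lemma to_matrix_is_monoid_morphism : monoid_morphism to_matrix.
Proof.
split=> [|a b]; apply/matrixP => i j; apply: val_inj.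
  rewrite !mxE rmorphMn rmorph1 /= /entry_val.
  under eq_bigr => k _ do rewrite mulr1 EM.
  by have [_|ij] := eqVneq i j; [rewrite mulr1n E1|rewrite big1].
rewrite !mxE rmorph_sum /=.
transitivity (\sum_k entry_val a i k * entry_val b k j); last first.
  by apply: eq_bigr => k _; rewrite !mxE.
(* The identity is inserted between [a] and [b] as the sum of the [E k k]. *)
transitivity (\sum_k \sum_l E l i * a * E k k * b * E j l).
  rewrite exchange_big /=; apply: eq_bigr => l _.
  rewrite -!mulr_suml -mulr_sumr E1 mulr1.
  by rewrite !mulrA.
apply: eq_bigr => k _; rewrite [entry_val b k j]/entry_val mulr_sumr.
by apply: eq_bigr => l _; rewrite !mulrA entry_val_unit.
Qed.

HB.instance Definition _ := GRing.isZmodMorphism.Build B _ to_matrix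
  to_matrix_is_zmod_morphism.
HB.instance Definition _ := GRing.isMonoidMorphism.Build B _ to_matrix
  to_matrix_is_monoid_morphism.

Lemma to_matrix_iso : ring_iso B 'M[matrix_centralizer]_n.
Proof. by exists to_matrix; apply: to_matrix_bij. Qed.

Lemma centralizer_base_subring :
  subring_set [set s : matrix_centralizer | val s \in R].
Proof.
split=> [|x y xR yR|x y xR yR] /=; first exact: rpred1.
  exact: rpredB.
exact: rpredM.
Qed.

Definition centralizer_base : subringClosed matrix_centralizer :=
  subring_of_set centralizer_base_subring.

Lemma mem_centralizer_base s : (s \in centralizer_base) <-> val s \in R.
Proof. by have := mem_subring_of_set centralizer_base_subring s. Qed.

Lemma entry_base b i j : b \in R -> entry b i j \in centralizer_base.
Proof.
move=> Rb; apply/mem_centralizer_base; apply: rpred_sum => k _.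
by rewrite !rpredM.
Qed.

Lemma of_matrix_base (M : 'M[matrix_centralizer]_n) :
  (forall i j, M i j \in centralizer_base) -> of_matrix M \in R.
Proof.
move=> MR; apply: rpred_sum => i _; apply: rpred_sum => j _; apply: rpredM => //.
by apply/mem_centralizer_base.
Qed.

(** An intermediate subring [A] of the centralizer gives the intermediate subring of elements of [B]
    with all entries in [A]. Scalar matrices recover [A] from it. *)
Lemma centralizer_base_maximal :
  (0 < n)%N -> maximal_subring R -> maximal_subring centralizer_base.
Proof.
move=> n0 maxR; have [RneT _] := maxR; pose i0 := Ordinal n0.
split=> [eT|A baseA].
  apply: RneT; apply/seteqP; split=> // b _ /=; rewrite -[b]to_matrixK.
  apply: of_matrix_base => i j.
  by have : [set` centralizer_base] (to_matrix b i j) by rewrite eT.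
have scalarE s : of_matrix s%:M = val s.
  rewrite /of_matrix -[RHS]mulr1 -E1 mulr_sumr; apply: eq_bigr => i _.
  rewrite (bigD1 i)//= big1 ?addr0 => [|j ji]; first by rewrite mxE eqxx mulr1n.
  by rewrite mxE eq_sym (negPf ji) mulr0n mul0r.
have scalar_entry s : to_matrix (val s) i0 i0 = s.
  by rewrite -scalarE of_matrixK mxE eqxx mulr1n.
have [|b Rb i j|e|e] := @maximal_subring_set _ _
  [set b : B | forall i j, to_matrix b i j \in A] maxR.
- split=> [i j|x y xA yA i j|x y xA yA i j].
  + by rewrite rmorph1 mxE rpredMn ?rpred1.
  + by rewrite rmorphB !mxE rpredB; move: (xA i j) (yA i j); rewrite ?mxE.
  + by rewrite rmorphM mxE rpred_sum // => k _; apply: rpredM.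
- by rewrite mxE; apply/baseA/entry_base.
- left; apply/seteqP; split=> [s As|s]; last exact: baseA.
  apply/mem_centralizer_base.
  suff : [set b : B | forall i j, to_matrix b i j \in A] (val s) by rewrite e.
  by move=> i j; rewrite -scalarE of_matrixK mxE rpredMn.
- right; apply/seteqP; split=> // s _ /=.
  have : [set b : B | forall i j, to_matrix b i j \in A] (val s) by rewrite e.
  by move=> /(_ i0 i0); rewrite scalar_entry.
Qed.

End MatrixUnits.

(** The centralizer of the units is a copy of [eAe]: [x] is determined by its corner [z], through
    [x * u i = u i * z] and [v i * x = z * v i]. The inverse of [z] is spread back along the
    diagonal. *)
Lemma centralizer_division (A : pzRingType) (e : A) n (u v : 'I_n -> A) (x : A) :
  (0 < n)%N -> division_idempotent e -> rank_one_units e u v ->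
  \sum_i u i * v i = 1 ->
  (forall i j, x * (u i * v j) = u i * v j * x) -> x <> 0 ->
  exists y, [/\ forall i j, y * (u i * v j) = u i * v j * y,
    x * y = 1 & y * x = 1].
Proof.
move=> n0 [e0 ee einv] [ue ev vu] uv1 xE x0; pose o := Ordinal n0.
pose z := v o * x * u o.
have voo : v o * u o = e by rewrite vu eqxx.
have xu i : x * u i = u i * z.
  by rewrite -[in LHS]ue -voo (mulrA (u i)) (mulrA x) xE /z -!mulrA.
have vx i : v i * x = z * v i.
  by rewrite -[in LHS]ev -voo -(mulrA (v o)) -(mulrA (v o)) -xE /z !mulrA.
have ez : e * z * e = z by rewrite /z !mulrA ev -mulrA ue.
have z0 : z <> 0.
  move=> z0; apply: x0; rewrite -[x]mulr1 -uv1 mulr_sumr big1 // => i _.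
  by rewrite mulrA xu z0 mulr0 mul0r.
have [w [ew zw wz]] := einv _ ez z0.
have we : w * e = w by rewrite -ew -!mulrA ee.
exists (\sum_i u i * w * v i); split=> [i j||].
- rewrite mulr_suml mulr_sumr (bigD1 i)//= [RHS](bigD1 j)//= !big1 ?addr0.
  + rewrite !mulrA -(mulrA (u i * w)) vu eqxx -(mulrA (u i) w) we.
    by rewrite -(mulrA (u i) (v j)) vu eqxx ue.
  + move=> k kj; rewrite !mulrA -(mulrA (u i)) vu eq_sym (negPf kj).
    by rewrite mulr0 !mul0r.
  + by move=> k ki; rewrite mulrA -(mulrA _ (v k)) vu (negPf ki) mulr0 mul0r.
- rewrite mulr_sumr -uv1; apply: eq_bigr => i _.
  by rewrite !mulrA xu -(mulrA (u i)) zw ue.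
- rewrite mulr_suml -uv1; apply: eq_bigr => i _.
  by rewrite -mulrA vx mulrA -(mulrA (u i)) wz ue.
Qed.

Lemma prime_artinian_matrix (B : pzRingType) (R : subringClosed B) :
  maximal_subring R -> prime_ring (subring_sort R) ->
  left_artinian (subring_sort R) ->
  exists (S : pzRingType) (n : nat),
    [/\ (0 < n)%N, ring_iso B 'M[S]_n &
        exists D : subringClosed S,
          maximal_subring D /\ division_ring (subring_sort D)].
Proof.
move=> maxR pR artR.
have [e edi] := prime_artinian_idempotent pR artR.
have [n [u [v [n0 uv uv1]]]] := prime_artinian_units pR artR edi.
pose E i j := val (u i * v j).
have ER i j : E i j \in R by apply: valP.
have [ue ev vu] := uv.
have EM i j k l : E i j * E k l = if j == k then E i l else 0.
  rewrite /E -rmorphM -mulrA (mulrA (v j)) vu.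
  by case: eqP => _; [rewrite ev|rewrite mul0r mulr0 rmorph0].
have E1 : \sum_i E i i = 1 by rewrite -rmorph_sum uv1 rmorph1.
exists (matrix_centralizer E), n; split=> //.
  exact: (to_matrix_iso EM E1).
exists (centralizer_base R E); split.
  exact: (centralizer_base_maximal ER EM E1).
split=> [/(congr1 (fun x => val (val x)))/= e10|d d0].
  have [R1 _] := pR; apply: R1; exact: val_inj.
have dR := valP d; move/mem_centralizer_base: dR => dR.
(* An element of the centralizer lying in [R] is read inside [R], inverted there, and packed back
   through both subtypes. *)
pose x : subring_sort R := Sub (val (val d)) dR.
have [i j||y [yE xy yx]] := centralizer_division n0 edi uv uv1 (x := x).
- by apply: val_inj; exact: (centralizerP (val d)).
- by move=> /(congr1 val) /= d0'; apply: d0; do 2!apply: val_inj.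
have yC : val y \in subring_of_set (centralizer_subring E).
  apply/mem_subring_of_set => i j; have /(congr1 val) := yE i j.
  by rewrite !rmorphM.
have yD : (Sub (val y) yC : matrix_centralizer E) \in centralizer_base R E.
  by apply/mem_centralizer_base; exact: (valP y).
exists (Sub (Sub (val y) yC : matrix_centralizer E) yD).
by split; do 2!apply: val_inj; [have := congr1 val xy|have := congr1 val yx].
Qed.

(** * The conductor of a maximal subring *)

Lemma conductor_sub (T : pzRingType) (R : subringClosed T) :
  conductor R `<=` [set` R].
Proof. by move=> x /(_ 1 1); rewrite mul1r mulr1. Qed.

(** With [conductor_sub], the conductor is the largest ideal of [T] inside [R]. *)
Lemma ideal_sub_conductor (T : pzRingType) (R : subringClosed T) (N : set T) :
  is_ideal N -> N `<=` [set` R] -> N `<=` conductor R.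
Proof. by move=> [_ _ Nl Nr] NR x Nx t s; apply: NR; apply: Nr; apply: Nl. Qed.

(** R + N is a subring properly above [R]. This is what makes T/N a quotient of [R]. *)
Lemma maximal_subring_add (T : pzRingType) (R : subringClosed T) (N : set T) :
  maximal_subring R -> is_ideal N -> ~ N `<=` [set` R] ->
  forall t, exists r n, [/\ r \in R, N n & t = r + n].
Proof.
move=> maxR [N0 NB Nl Nr] nNR t.
have ND x y : N x -> N y -> N (x + y).
  by move=> Nx Ny; apply: left_idealD.
have [||e|e] := @maximal_subring_set _ _ (ideal_add [set` R] N) maxR.
- split.
  + by exists 1, 0; rewrite addr0; split=> //; apply: rpred1.
  + move=> _ _ [r [n [Rr Nn ->]]] [s [m [Rs Nm ->]]].
    exists (r - s), (n - m); split; [exact: rpredB|exact: NB|].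
    by rewrite opprD addrACA.
  + move=> _ _ [r [n [Rr Nn ->]]] [s [m [Rs Nm ->]]].
    exists (r * s), (r * m + n * (s + m)); split; first exact: rpredM.
      by apply: ND; [apply: Nl|apply: Nr].
    by rewrite mulrDl mulrDr addrA.
- by move=> r Rr; exists r, 0; rewrite addr0.
- case: nNR => n Nn; rewrite -e; exists 0, n.
  by rewrite add0r; split=> //; apply: rpred0.
- have : ideal_add [set` R] N t by rewrite e.
  by move=> [r [n []]]; exists r, n.
Qed.

(** If R + U = R, then bT <= U <= R and [b] is in the right conductor; otherwise R + U = T yields
    aTb <= I. In that case the ideal [V] contains [a]: either V <= R, so [a] is in [I], or R + V = T
    gives Tb <= R, so [b] is in the left conductor. *)
Lemma conductor_prime (T : pzRingType) (R : subringClosed T) a b :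
  maximal_subring R ->
  conductor_l R = conductor R -> conductor R = conductor_r R ->
  a \in R -> b \in R -> (forall r, r \in R -> conductor R (a * r * b)) ->
  conductor R a \/ conductor R b.
Proof.
move=> maxR el er Ra Rb aRb; set I := conductor R.
have [I0 IB Il Ir] : is_ideal I := conductor_is_ideal R.
have ID x y : I x -> I y -> I (x + y).
  by apply: (@left_idealD T I).
(* [U] is a right ideal of [T] stable under left multiplication by [R], so  *)
(* [R + U] is a subring.                                                    *)
pose U := [set u | forall r, r \in R -> I (a * r * u)].
have UT u t : U u -> U (u * t).
  by move=> Uu r Rr; rewrite mulrA; apply: Ir; apply: Uu.
have aTb t : I b \/ I (a * t * b).
  have [||e|e] := @maximal_subring_set _ _ (ideal_add [set` R] U) maxR.
  - split.
    + by exists 1, 0; rewrite addr0; split=> //;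
        [apply: rpred1|move=> r _; rewrite mulr0].
    + move=> _ _ [r [u [Rr Uu ->]]] [s [w [Rs Uw ->]]].
      exists (r - s), (u - w); split; [exact: rpredB| |by rewrite opprD addrACA].
      by move=> x Rx; rewrite mulrBr; apply: IB; [apply: Uu|apply: Uw].
    + move=> _ _ [r [u [Rr Uu ->]]] [s [w [Rs Uw ->]]].
      exists (r * s), (r * w + u * (s + w)); split; first exact: rpredM.
        move=> x Rx; rewrite mulrDr; apply: ID; last exact: UT.
        by rewrite mulrA -(mulrA a); apply: Uw; apply: rpredM.
      by rewrite mulrDl mulrDr addrA.
  - by move=> r Rr; exists r, 0; rewrite addr0; split=> // x _; rewrite mulr0.
  - left; rewrite /I er => s.
    suff : [set` R] (b * s) by [].
    rewrite -e; exists 0, (b * s); rewrite add0r; split=> //; first exact: rpred0.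
    by apply: UT => r Rr; apply: aRb.
  - have : ideal_add [set` R] U t by rewrite e.
    move=> [r [u [Rr Uu ->]]]; right; rewrite mulrDr mulrDl.
    apply: ID; first exact: aRb.
    by apply: Ir; rewrite -[a]mulr1; apply: Uu; apply: rpred1.
have [Ib|nIb] := pselect (I b); first by right.
left; have {}aTb t : I (a * t * b) by have [] := aTb t.
pose V := [set v | forall t, I (v * t * b)].
have Vi : is_ideal V.
  split=> [t|x y Vx Vy t|s x Vx t|s x Vx t].
  - by rewrite !mul0r.
  - by rewrite !mulrBl; apply: IB; [apply: Vx|apply: Vy].
  - by rewrite -!mulrA; apply: Il; rewrite mulrA; apply: Vx.
  - by rewrite -(mulrA x); apply: Vx.
have [VR|nVR] := pselect (V `<=` [set` R]).
  by apply: (ideal_sub_conductor Vi VR) => t; apply: aTb.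
exfalso; apply: nIb; rewrite /I -el => t.
have [r [v [Rr Vv ->]]] := maximal_subring_add maxR Vi nVR t.
rewrite mulrDl; apply: rpredD; first exact: rpredM.
by have := Vv 1; rewrite mulr1 => /conductor_sub.
Qed.

Section QuotientSubring.
Variables (T : pzRingType) (R : subringClosed T) (I : ideal T).

Lemma quot_subring_set :
  subring_set [set b : ring_quot I | exists2 x, x \in R & quot_proj I x = b].
Proof.
split=> [|_ _ [x Rx <-] [y Ry <-]|_ _ [x Rx <-] [y Ry <-]].
- by exists 1; [exact: rpred1|].
- by exists (x - y); [exact: rpredB|exact: quot_projB].
- by exists (x * y); [exact: rpredM|exact: quot_projM].
Qed.

Definition quot_subring : subringClosed (ring_quot I) :=
  subring_of_set quot_subring_set.

Lemma quot_subringP b :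
  b \in quot_subring <-> exists2 x, x \in R & quot_proj I x = b.
Proof. exact: mem_subring_of_set. Qed.

Lemma to_quot_subring_subproof (x : subring_sort R) :
  quot_proj I (val x) \in quot_subring.
Proof. by apply/quot_subringP; exists (val x); first exact: valP. Qed.

Definition to_quot_subring (x : subring_sort R) : subring_sort quot_subring :=
  Sub (quot_proj I (val x)) (to_quot_subring_subproof x).

Lemma to_quot_subringB x y :
  to_quot_subring (x - y) = to_quot_subring x - to_quot_subring y.
Proof. by apply: val_inj; rewrite raddfB /= quot_projB. Qed.

Lemma to_quot_subringM x y :
  to_quot_subring (x * y) = to_quot_subring x * to_quot_subring y.
Proof. by apply: val_inj; rewrite rmorphM /= quot_projM. Qed.

Lemma to_quot_subring_surj b : exists x, to_quot_subring x = b.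
Proof.
have /quot_subringP[x Rx e] := valP b.
by exists (Sub x Rx); apply: val_inj.
Qed.

Lemma to_quot_subring_eq0 x : to_quot_subring x = 0 <-> ideal_set I (val x).
Proof.
rewrite -quot_proj_eq0; split=> [/(congr1 val)//|e].
by apply: val_inj; rewrite SubK e.
Qed.

Lemma quot_subring_artinian :
  left_artinian (subring_sort R) -> left_artinian (subring_sort quot_subring).
Proof.
exact: left_artinian_surj to_quot_subringB to_quot_subringM to_quot_subring_surj.
Qed.

(** As [I] lies in [R], the subring [R] is the full preimage of its image, so intermediate subrings
    can be pulled back to [T]. *)
Lemma quot_subring_maximal :
  I `<=` [set` R] -> maximal_subring R -> maximal_subring quot_subring.
Proof.
move=> IR maxR; have [RneT _] := maxR.
have projR x : quot_proj I x \in quot_subring -> x \in R.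
  move=> /quot_subringP[y Ry /esym /quot_proj_eq Ixy].
  by rewrite -(subrK y x) rpredD //; apply: IR.
split=> [eT|A subA].
  apply: RneT; apply/seteqP; split=> // x _; apply: projR.
  suff : [set` quot_subring] (quot_proj I x) by [].
  by rewrite eT.
have [|x Rx|e|e] := @maximal_subring_set _ _ (quot_proj I @^-1` [set` A]) maxR.
- split=> /= [|x y Ax Ay|x y Ax Ay].
  + by rewrite quot_proj1 rpred1.
  + by rewrite quot_projB rpredB.
  + by rewrite quot_projM rpredM.
- by apply: subA; apply/quot_subringP; exists x.
- left; apply/seteqP; split=> b; have [x <-] := quot_proj_surj b => /=.
    move=> Ax; apply/quot_subringP; exists x => //.
    by have : (quot_proj I @^-1` [set` A]) x by []; rewrite e.
  by move=> /subA.
- right; apply/seteqP; split=> // b _; have [x <-] := quot_proj_surj b.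
  by have : (quot_proj I @^-1` [set` A]) x by rewrite e.
Qed.

End QuotientSubring.

Lemma conductor_quot_prime (T : pzRingType) (R : subringClosed T) :
  maximal_subring R ->
  conductor_l R = conductor R -> conductor R = conductor_r R ->
  prime_ring (subring_sort (quot_subring R (conductor_ideal R))).
Proof.
move=> maxR el er; split=> [/(congr1 val)/=|a b].
  rewrite -quot_proj1 => /quot_proj_eq0 I1; have [RneT _] := maxR.
  apply: RneT; apply/seteqP; split=> // x _ /=.
  by have := I1 x 1; rewrite !mulr1.
have [x <-] := to_quot_subring_surj a; have [y <-] := to_quot_subring_surj b.
move=> ab0.
have [r Rr|Ix|Iy] := @conductor_prime _ _ (val x) (val y) maxR el er
  (valP x) (valP y).
- apply: (to_quot_subring_eq0 (conductor_ideal R) (x * Sub r Rr * y)).1.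
  by rewrite !to_quot_subringM.
- by left; apply/(to_quot_subring_eq0 _ x).
- by right; apply/(to_quot_subring_eq0 _ y).
Qed.

Lemma conductor_maximal_in_subring (T : pzRingType) (R : subringClosed T) :
  maximal_subring R -> left_artinian (subring_sort R) ->
  conductor_l R = conductor R -> conductor R = conductor_r R ->
  is_maximal_ideal [set r : subring_sort R | conductor R (val r)].
Proof.
move=> maxR artR el er; set I := conductor_ideal R.
have -> : [set r | conductor R (val r)] =
    [set r : subring_sort R | to_quot_subring I r = 0].
  by apply/seteqP; split=> r; have [] := to_quot_subring_eq0 I r.
apply: ker_maximal.
- exact: to_quot_subringB.
- exact: to_quot_subringM.
- exact: to_quot_subring_surj.
- apply: prime_artinian_simple; first exact: conductor_quot_prime.
  exact: quot_subring_artinian.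
Qed.

(** * Prime and maximal ideals over a maximal subring *)

Section PrimesOfMaximalSubring.
Variables (T : pzRingType) (R : subringClosed T).
Hypothesis maxR : maximal_subring R.
Hypothesis artR : left_artinian (subring_sort R).

(** As R + N = T, the prime ring T/N is an image of [R], hence left Artinian. *)
Lemma prime_quot_simple (N : ideal T) :
  is_prime_ideal N -> ~ N `<=` [set` R] -> simple_ring (ring_quot N).
Proof.
move=> Np nNR; have Ni := idealP N.
apply: prime_artinian_simple; first exact: prime_quotient.
apply: (@left_artinian_surj _ _ (fun r : subring_sort R => quot_proj N (val r))).
- by move=> x y; rewrite rmorphB quot_projB.
- by move=> x y; rewrite rmorphM quot_projM.
- move=> b; have [t <-] := quot_proj_surj b.
  have [r [n [Rr Nn ->]]] := maximal_subring_add maxR Ni nNR t.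
  exists (Sub r Rr); apply/quot_proj_eq.
  rewrite SubK opprD addNKr; apply: (left_idealN (I := N)) => //.
  exact: left_ideal_of_ideal.
- exact: artR.
Qed.

Lemma prime_not_sub_maximal (N : set T) :
  is_prime_ideal N -> ~ N `<=` [set` R] -> is_maximal_ideal N.
Proof.
move=> Np nNR; have [Ni _ _] := Np.
have := @ker_maximal _ _ (quot_proj (Ideal Ni)).
have -> : [set x | quot_proj (Ideal Ni) x = 0] = N.
  by apply/seteqP; split=> x /=; have [] := quot_proj_eq0 (Ideal Ni) x.
apply; [exact: quot_projB|exact: quot_projM|exact: quot_proj_surj|].
exact: prime_quot_simple.
Qed.

(** The restriction to [R] of the projection onto the simple ring T/N is still onto. This is the
    source of the map from [Max T] to [Max R]. *)
Lemma prime_not_sub_trace (N : set T) :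
  is_prime_ideal N -> ~ N `<=` [set` R] ->
  is_maximal_ideal [set r : subring_sort R | N (val r)].
Proof.
move=> Np nNR; have [Ni _ _] := Np.
have := @ker_maximal _ _ (fun r : subring_sort R => quot_proj (Ideal Ni) (val r)).
have -> : [set r : subring_sort R | quot_proj (Ideal Ni) (val r) = 0] =
    [set r | N (val r)].
  by apply/seteqP; split=> x /=; have [] := quot_proj_eq0 (Ideal Ni) (val x).
apply; last exact: prime_quot_simple.
- by move=> x y; rewrite rmorphB quot_projB.
- by move=> x y; rewrite rmorphM quot_projM.
- move=> b; have [t <-] := quot_proj_surj b.
  have [r [n [Rr Nn ->]]] := maximal_subring_add maxR Ni nNR t.
  exists (Sub r Rr); apply/quot_proj_eq.
  rewrite SubK opprD addNKr; apply: (left_idealN (I := N)) => //.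
  exact: left_ideal_of_ideal.
Qed.

Section UniqueMaximal.
Variable Q : set T.
Hypothesis Qmax : is_maximal_ideal Q.
Hypothesis IQ : conductor R `<=` Q.
Hypothesis Quniq : forall Q', is_maximal_ideal Q' -> conductor R `<=` Q' -> Q' = Q.

Lemma maximal_not_sub N : is_maximal_ideal N -> N <> Q -> ~ N `<=` [set` R].
Proof.
move=> Nmax NneQ NR; have [Ni _ maxN] := Nmax; have [Qi QneT _] := Qmax.
have NQ : N `<=` Q by apply: subset_trans IQ; apply: ideal_sub_conductor.
by have [/esym|] := maxN _ Qi NQ.
Qed.

Lemma Max_decomposition :
  Max T = [set Q] `|` [set N | Spec T N /\ ~ (N `<=` [set` R])].
Proof.
apply/seteqP; split=> [N Nmax|N [->|[Np nNR]]] //=.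
  have [->|NneQ] := pselect (N = Q); first by left.
  by right; split; [exact: maximal_ideal_prime|exact: maximal_not_sub].
exact: prime_not_sub_maximal.
Qed.

Lemma prime_max_or_sub P : Spec T P -> Max T P \/ P `<=` Q.
Proof.
move=> Pp; have [PR|nPR] := pselect (P `<=` [set` R]).
  right; apply: subset_trans IQ; apply: ideal_sub_conductor => //.
  by case: Pp.
by left; apply: prime_not_sub_maximal.
Qed.

(* The top of a chain of primes can be replaced by [Q]: the members strictly *)
(* below the top are not maximal, hence lie in [Q].                          *)
Lemma krull_dim_height : krull_dim T = height Q.
Proof.
rewrite /krull_dim /height; congr nat_sup; apply/seteqP; split=> k /=; last first.
  by move=> [P [Pc _]]; exists P.
move=> [P [Pp Plt]]; exists (fun i => if i == k then Q else P i).
rewrite eqxx; split=> //; split=> i ik; case: eqP => // ei.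
- exact: maximal_ideal_prime.
- exact: Pp.
- by rewrite ei ltnn in ik.
have [PPS PSP] := Plt i ik.
have nPmax : ~ Max T (P i).
  move=> [_ _ maxP]; have [SPi SPneT _] := Pp _ ik.
  have [e|//] := maxP _ SPi PPS.
  by apply: PSP; rewrite e.
have PQ : P i `<=` Q by have [] := prime_max_or_sub (Pp _ (ltnW ik)).
case: eqP => [_|nek]; last exact: Plt.
split=> // QP; apply: nPmax.
by have -> : P i = Q by apply/seteqP.
Qed.

(** The sum of the conductor and [N] is [N] or [T], and in the first case uniqueness of [Q] forces
    [N = Q]. *)
Lemma conductor_maximal_coprime N : is_maximal_ideal N -> N <> Q ->
  exists i n, [/\ conductor R i, N n & 1 = i + n].
Proof.
move=> Nmax NneQ; have [Ni NneT maxN] := Nmax.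
have Ii := conductor_is_ideal R.
have [e|e] := maxN _ (ideal_of_add Ii Ni)
    (@ideal_addr _ _ _ (left_ideal_of_ideal Ii)).
  case: NneQ; apply: Quniq => //; rewrite -e.
  exact/ideal_addl/left_ideal_of_ideal.
have : ideal_add (conductor R) N 1 by rewrite e.
by move=> [i [n []]]; exists i, n.
Qed.

(** Write [1 = i + n]. For [x] in [N1], the term [i * x] lies in [N1] and in the conductor, hence in
    [R]; and [n = 1 - i] itself lies in [N1] and [R]. *)
Lemma maximal_trace_sub N1 N2 : is_maximal_ideal N1 -> is_maximal_ideal N2 ->
  N1 <> Q -> N1 `&` [set` R] `<=` N2 -> N1 `<=` N2.
Proof.
move=> N1max [N2i _ _] N1Q sub x N1x.
have [[_ _ N1l N1r] _ _] := N1max.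
have [i [n [Ii N1n e1]]] := conductor_maximal_coprime N1max N1Q.
have Rn : n \in R.
  have -> : n = 1 - i by rewrite e1 addrC addKr.
  by apply: rpredB; [exact: rpred1|exact: conductor_sub].
rewrite -[x]mul1r e1 mulrDl; apply: left_idealD.
- exact: left_ideal_of_ideal.
- apply: sub; split; first exact: N1l.
  by have := Ii 1 x; rewrite mul1r.
- by case: N2i => _ _ _; apply; apply: sub.
Qed.

Lemma maximal_trace_inj N1 N2 : is_maximal_ideal N1 -> is_maximal_ideal N2 ->
  N1 <> Q -> N2 <> Q -> N1 `&` [set` R] = N2 `&` [set` R] -> N1 = N2.
Proof.
move=> N1max N2max N1Q N2Q e; apply/seteqP; split.
  by apply: maximal_trace_sub => //; rewrite e => x [].
by apply: maximal_trace_sub => //; rewrite -e => x [].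
Qed.

Lemma card_Max_le :
  is_maximal_ideal [set r : subring_sort R | conductor R (val r)] ->
  Max T #<= Max (subring_sort R).
Proof.
(* At [Q] the value is written as the conductor: Q ∩ R is the same ideal, being proper and above the
   maximal ideal [Imax]. *)
move=> Imax; pose trace (N : set T) : set (subring_sort R) :=
  [set r | (if `[< N = Q >] then conductor R else N) (val r)].
have traceE N1 N2 (N1' N2' : set T) :
    [set r : subring_sort R | N1 (val r)] = [set r | N2 (val r)] ->
    N1 `&` [set` R] = N2 `&` [set` R].
  move=> e; apply/seteqP; split=> x [Nx Rx]; split=> //.
    suff : [set r : subring_sort R | N2 (val r)] (Sub x Rx) by [].
    by rewrite -e.
  suff : [set r : subring_sort R | N1 (val r)] (Sub x Rx) by [].
  by rewrite e.
(* No other maximal ideal has this trace, since it would contain the conductor. *)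
have notI N : is_maximal_ideal N -> N <> Q ->
    [set r : subring_sort R | N (val r)] <>
    [set r | conductor R (val r)].
  move=> Nmax NQ e; apply: NQ; apply: Quniq => // i Ii.
  have : [set r : subring_sort R | conductor R (val r)] (Sub i (conductor_sub Ii)).
    by [].
  by rewrite -e.
have trace_inj : {in Max T &, injective trace}.
  move=> N1 N2 /set_mem N1max /set_mem N2max; rewrite /trace.
  case: asboolP => [->|N1Q]; case: asboolP => [->|N2Q] // e.
  - by case: (notI N2).
  - by case: (notI N1).
  - by apply: maximal_trace_inj => //; apply: traceE.
apply: (@card_le_trans _ _ _ (trace @` Max T)); last first.
  apply: subset_card_le => _ [N Nmax <-]; rewrite /trace; case: asboolP => // NQ.
  apply: prime_not_sub_trace; first exact: maximal_ideal_prime.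
  exact: maximal_not_sub.
by have := inj_card_eq trace_inj; rewrite card_eq_sym card_eq_le => /andP[].
Qed.

End UniqueMaximal.

(** * Chain conditions and the Jacobson radical of [T] *)

Lemma chain_sub (X : nat -> set T) :
  (forall k, X k.+1 `<=` X k) -> forall k m, (k <= m)%N -> X m `<=` X k.
Proof.
move=> dX k m /subnKC <-; elim: (m - k)%N => [|j IH]; first by rewrite addn0.
by rewrite addnS; apply: subset_trans IH.
Qed.

Lemma trace_stationary (X : nat -> set T) :
  (forall k, is_left_ideal (X k)) -> (forall k, X k.+1 `<=` X k) ->
  exists k, forall m, (k <= m)%N -> X k `&` [set` R] `<=` X m.
Proof.
move=> Xl dX.
have [k|k r /= Xr|k kP] := artR (I := fun k => [set r | X k (val r)]).
- have [X0 XB Xm] := Xl k; split=> [|x y Xx Xy|t x Xx] //.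
  + exact: (XB (val x) (val y)).
  + exact: (Xm (val t) (val x)).
- exact: dX.
exists k => m /kP e x [Xx Rx].
suff : [set r : subring_sort R | X m (val r)] (Sub x Rx) by [].
by rewrite e.
Qed.

(** Beyond stage [k], the chains X + L, (X ∩ L) + K and X ∩ R are all stationary. An element of
    [X k] is reduced modulo [X m] first into [L], then into K ∩ L, which lies in [R], where the
    third chain applies. *)
Lemma artinian_of_two_ideals (K L : set T) :
  is_ideal K -> is_ideal L -> K `&` L `<=` [set` R] ->
  ~ K `<=` [set` R] -> ~ L `<=` [set` R] -> left_artinian T.
Proof.
move=> Ki Li KLR nKR nLR X Xl dX.
have [Kl Ll] := (left_ideal_of_ideal Ki, left_ideal_of_ideal Li).
have mono A (B C : set T) : B `<=` C -> ideal_add B A `<=` ideal_add C A.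
  by move=> BC _ [b [a [/BC Cb Aa ->]]]; exists b, a.
have XL k : is_left_ideal (X k `&` L) by apply: left_ideal_cap.
have XLK k : is_left_ideal (ideal_add (X k `&` L) K) by apply: left_ideal_add.
have XpL k : is_left_ideal (ideal_add (X k) L) by apply: left_ideal_add.
have [k1 st1] := trace_stationary Xl dX.
have [|k2 st2] := trace_stationary XLK.
  by move=> k; apply: mono; apply: setSI.
have [|k3 st3] := trace_stationary XpL.
  by move=> k; apply: mono.
pose k := maxn k1 (maxn k2 k3); exists k => m km.
have [k1k k2k k3k] : [/\ (k1 <= k)%N, (k2 <= k)%N & (k3 <= k)%N].
  by rewrite /k !leq_max !leqnn !orbT.
have dXk := chain_sub dX km.
(* Left ideals containing [N] are compared through their traces: in [y = r + n] the part [n] lies in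
   both, and [r = y - n] is in the trace of [Y]. *)
have sub N (Y Z : set T) : is_ideal N -> ~ N `<=` [set` R] ->
    is_left_ideal Y -> is_left_ideal Z -> N `<=` Y -> N `<=` Z ->
    Y `&` [set` R] `<=` Z -> Y `<=` Z.
  move=> Ni nNR Yl Zl NY NZ YRZ y Yy.
  have [r [n [Rr Nn ey]]] := maximal_subring_add maxR Ni nNR y.
  rewrite ey; apply: left_idealD => //; last exact: NZ.
  apply: YRZ; split=> //; have -> : r = y - n by rewrite ey addrK.
  by case: Yl => _ YB _; apply: YB => //; apply: NY.
have sub3 : ideal_add (X k) L `<=` ideal_add (X m) L.
  apply: (sub L) => //; try exact: ideal_addr.
  move=> x [Xx Rx]; apply: st3; first exact: leq_trans km.
  split=> //; move: Xx; apply: mono; exact: chain_sub.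
have sub2 : ideal_add (X k `&` L) K `<=` ideal_add (X m `&` L) K.
  apply: (sub K) => //; try exact: ideal_addr.
  move=> x [Xx Rx]; apply: st2; first exact: leq_trans km.
  split=> //; move: Xx; apply: mono; apply: setSI; exact: chain_sub.
apply/seteqP; split=> // x Xx.
have [x' [l [Xx' Ll' ex]]] : ideal_add (X m) L x.
  by apply: sub3; apply: ideal_addl.
have [_ XB _] := Xl k; have [_ LB _] := Ll.
have Xl' : X k l by have -> : l = x - x' by [rewrite ex addrC addKr]; apply/XB/dXk.
have [x'' [z [[Xx'' Lx''] Kz el]]] : ideal_add (X m `&` L) K l.
  by apply: sub2; apply: ideal_addl.
have ez : z = l - x'' by rewrite el addrC addKr.
have Xz : X k z by rewrite ez; apply/XB/dXk.
have Lz : L z by rewrite ez; apply: LB.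
have Xmz : X m z.
  apply: st1; first exact: leq_trans km.
  by split; [apply: (chain_sub dX k1k)|apply: KLR].
by rewrite ex el; do 2?[apply: left_idealD => //].
Qed.

(** Otherwise maximality gives [1 = p + j] with [p] in the conductor and [j] in the radical, and
    [p = 1 - j] is left invertible. *)
Lemma jacobson_sub_conductor :
  is_maximal_ideal [set r : subring_sort R | conductor R (val r)] ->
  jacobson (subring_sort R) `<=` [set r | conductor R (val r)].
Proof.
set P := [set r | _] => -[Pi PneT Pmax].
have Ji := jacobson_ideal (subring_sort R).
have [e|e] := Pmax _ (ideal_of_add Pi Ji)
    (@ideal_addl _ _ _ (left_ideal_of_ideal Ji)).
  by rewrite -e; apply/ideal_addr/left_ideal_of_ideal.
have : ideal_add P (jacobson (subring_sort R)) 1 by rewrite e.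
move=> [p [j [Pp Jj e1]]]; exfalso; apply: PneT.
apply: left_ideal1; first exact: left_ideal_of_ideal.
have [u <-] := (jacobsonP j).1 Jj 1; case: Pi => _ _ Pl _; apply: Pl.
by rewrite mul1r e1 addrK.
Qed.

(** The powers of [x] generate a descending chain, so [x ^+ k = t * x ^+ k.+1] for some [t]; now
    cancel the left invertible [1 - t * x]. *)
Lemma jacobson_artinian_nil (x : T) :
  left_artinian T -> jacobson T x -> exists k, x ^+ k = 0.
Proof.
move=> artT /jacobsonP Jx.
have [|k _ [a ->]|k kP] := artT (fun k => [set y | exists a, y = a * x ^+ k]).
- by move=> k; apply: left_ideal_principal.
- by exists (a * x); rewrite exprS mulrA.
exists k; have [t xk] : [set y | exists a, y = a * x ^+ k.+1] (x ^+ k).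
  by rewrite kP //; exists 1; rewrite mul1r.
have [u eu] := Jx t.
by rewrite -[x ^+ k]mul1r -eu -mulrA mulrBl mul1r -mulrA -exprS -xk subrr mulr0.
Qed.

Lemma nilpotent_left_inverse (A : pzRingType) (z : A) k :
  z ^+ k = 0 -> exists u, u * (1 - z) = 1.
Proof.
suff [u eu] : exists u, u * (1 - z) = 1 - z ^+ k.
  by move=> zk; exists u; rewrite eu zk subr0.
elim: k => [|k [u eu]]; first by exists 0; rewrite mul0r subrr.
by exists (u + z ^+ k); rewrite mulrDl eu mulrBr mulr1 addrA subrK exprSr.
Qed.

Lemma jacobson_trace :
  is_maximal_ideal [set r : subring_sort R | conductor R (val r)] ->
  left_artinian T ->
  val @` jacobson (subring_sort R) = jacobson T `&` [set` R].
Proof.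
move=> Imax artT; apply/seteqP; split=> [_ [y Jy <-]|x [Jx Rx]].
  split; last exact: valP.
  have Iy := jacobson_sub_conductor Imax Jy.
  (* [t * val y * t] lies in [R] because [y] is in the conductor, so [1 - w * y] has a left inverse
     in [R]; in [T] it is [1 - (t y)^2 = (1 + t y)(1 - t y)]. *)
  apply/jacobsonP => t; pose w : subring_sort R := Sub (t * val y * t) (Iy t t).
  have [u eu] := (jacobsonP y).1 Jy w.
  exists (val u * (1 + t * val y)).
  have {}eu : val u * (1 - t * val y * t * val y) = 1 by have := congr1 val eu.
  by rewrite -mulrA mulrDl mul1r mulrBr mulr1 addrA subrK !mulrA.
(* [r * x] is nilpotent, as an element of the radical of the left Artinian ring [T], so the inverse
   of [1 - r * x] is a polynomial in [r * x] and stays in [R]. *)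
exists (Sub x Rx) => //; apply/jacobsonP => r.
have Jrx : jacobson T (val r * x).
  by have [_ _ Jl _] := jacobson_ideal T; apply: Jl.
have [k ek] := jacobson_artinian_nil artT Jrx.
apply: (@nilpotent_left_inverse _ _ k); apply: val_inj.
by rewrite rmorphXn rmorphM /= ek.
Qed.

End PrimesOfMaximalSubring.

(** * Ideals of S and of the matrix ring *)

Section LeftQuotient.
Local Open Scope quotient_scope.
Variables (T : pzRingType) (N : set T) (Nl : is_left_ideal N).

Definition left_ideal_pred : {pred T} := fun x => `[< N x >].

Lemma left_ideal_pred_closed : zmod_closed left_ideal_pred.
Proof.
have [N0 NB _] := Nl.
by split=> [|x y /asboolP Nx /asboolP Ny]; apply/asboolP => //; apply: NB.
Qed.

HB.instance Definition _ :=
  GRing.isZmodClosed.Build T left_ideal_pred left_ideal_pred_closed.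

(** [N] is only a left ideal, so this quotient carries a scalar action of [T] but no product. *)
Definition left_quot : Type := Quotient.quot left_ideal_pred.

HB.instance Definition _ := GRing.Zmodule.on left_quot.
HB.instance Definition _ :=
  EqQuotient.copy left_quot (Quotient.quot left_ideal_pred).
HB.instance Definition _ :=
  ZmodQuotient.copy left_quot (Quotient.quot left_ideal_pred).

Lemma left_quot_eqP (x y : T) :
  \pi_left_quot x = \pi_left_quot y <-> N (x - y).
Proof.
split=> [/eqP|Nxy].
  by rewrite -[_ == _]Quotient.idealrBE => /asboolP.
by apply/eqP; rewrite -[_ == _]Quotient.idealrBE; apply/asboolP.
Qed.

Definition left_quot_scale (a : T) (b : left_quot) : left_quot :=
  \pi_left_quot (a * repr b).

Lemma left_quot_scaleE a x :
  left_quot_scale a (\pi_left_quot x) = \pi_left_quot (a * x).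
Proof.
apply/left_quot_eqP; rewrite -mulrBr; have [_ _] := Nl; apply.
by apply/left_quot_eqP; rewrite reprK.
Qed.

Lemma left_quot_piD x y :
  \pi_left_quot (x + y) = \pi_left_quot x + \pi_left_quot y.
Proof. exact: pi_addr. Qed.

Lemma left_quot_scaleA a b v :
  left_quot_scale a (left_quot_scale b v) = left_quot_scale (a * b) v.
Proof. by rewrite -[v](@reprK _ left_quot) !left_quot_scaleE mulrA. Qed.

Lemma left_quot_scale1 : left_id 1 left_quot_scale.
Proof. by move=> v; rewrite -[v in LHS]reprK left_quot_scaleE mul1r reprK. Qed.

Lemma left_quot_scaleDr : right_distributive left_quot_scale +%R.
Proof.
move=> a v w; rewrite -[v](@reprK _ left_quot) -[w](@reprK _ left_quot) -left_quot_piD.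
by rewrite !left_quot_scaleE mulrDr left_quot_piD.
Qed.

Lemma left_quot_scaleDl v : {morph left_quot_scale^~ v : a b / a + b}.
Proof.
move=> a b; rewrite -[v](@reprK _ left_quot) !left_quot_scaleE.
by rewrite mulrDl left_quot_piD.
Qed.

HB.instance Definition _ := GRing.Zmodule_isLmodule.Build T left_quot
  left_quot_scaleA left_quot_scale1 left_quot_scaleDr left_quot_scaleDl.

Lemma left_quot_pi0 x : \pi_left_quot x = 0 :> left_quot <-> N x.
Proof.
have -> : 0 = \pi_left_quot 0 :> left_quot by rewrite -pi_zeror.
by rewrite left_quot_eqP subr0.
Qed.

Lemma left_quot_scaleP a x :
  a *: (\pi_left_quot x : left_quot) = \pi_left_quot (a * x).
Proof. exact: left_quot_scaleE. Qed.

Lemma left_quot_simple :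
  is_maximal_left_ideal N -> simple_module (left_quot : lmodType T).
Proof.
move=> [_ NneT Nmax]; split.
  exists (\pi_left_quot 1 : left_quot) => /left_quot_pi0 N1.
  by apply: NneT; apply: left_ideal1.
move=> W W0 WD WZ.
have [||e|e] := Nmax [set x | W (\pi_left_quot x : left_quot)].
- split=> [|x y Wx Wy|t x Wx] /=.
  + by have -> : \pi_left_quot 0 = 0 :> left_quot by rewrite -pi_zeror.
  + rewrite left_quot_piD; apply: WD => //.
    by rewrite -mulN1r -left_quot_scaleP; apply: WZ.
  + by rewrite -left_quot_scaleP; apply: WZ.
- by move=> x /left_quot_pi0 /= ->.
- left; apply/seteqP; split=> [v Wv|_ ->] //=.
  rewrite -[v](@reprK _ left_quot); apply/left_quot_pi0; rewrite -e /=.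
  by rewrite reprK.
- right; apply/seteqP; split=> // v _; rewrite -[v](@reprK _ left_quot).
  suff : [set x | W (\pi_left_quot x : left_quot)] (repr v) by [].
  by rewrite e.
Qed.

End LeftQuotient.

(** The annihilator of the simple module T/N is an ideal inside [N]. *)
Lemma primitive_of_maximal_left (T : pzRingType) (N : set T) :
  is_maximal_left_ideal N ->
  (forall K, is_ideal K -> K `<=` N -> K `<=` [set 0]) ->
  primitive_ring T.
Proof.
move=> Nmax Nfaith; have [Nl _ _] := Nmax.
exists (left_quot Nl : lmodType T); split; first exact: left_quot_simple.
move=> t tV.
pose K := [set x | forall s, N (x * s)].
apply: (Nfaith K).
- have [N0 NB Nm] := Nl.
  split=> [s|x y Kx Ky s|r x Kx s|r x Kx s].
  + by rewrite mul0r.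
  + by rewrite mulrBl; apply: NB; [apply: Kx|apply: Ky].
  + by rewrite -mulrA; apply: Nm; apply: Kx.
  + by rewrite -mulrA; apply: Kx.
- by move=> x Kx; rewrite -[x]mulr1; apply: Kx.
- by move=> s; apply/(left_quot_pi0 Nl); rewrite -left_quot_scaleP.
Qed.

(** * The Jacobson radical and the proper ideals of [S] *)

(** [r * m] squares to 0, so [1 + r * m] inverts [1 - r * m]. *)
Lemma jacobson_square_zero (S : pzRingType) (M : set S) :
  is_ideal M -> ideal_mul M M = [set 0] -> M `<=` jacobson S.
Proof.
move=> [_ _ Ml _] M2 m Mm; apply/jacobsonP => r; exists (1 + r * m).
have : ideal_mul M M (r * m * (r * m)) by apply: ideal_mulI; apply: Ml.
rewrite M2 => /= e.
by rewrite mulrDl mul1r mulrBr mulr1 e subr0 subrK.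
Qed.

(** The radical is a proper ideal, so it is 0 or [M]. If it is 0, some maximal left ideal [N] does
    not contain [M]; then [N] contains no nonzero ideal, and S/N is faithful. *)
Lemma unique_ideal_jacobson (S : pzRingType) (M : set S) :
  unique_nonzero_proper_ideal M -> primitive_ring S \/ jacobson S = M.
Proof.
move=> [[Mi M0 MneT] Muniq].
have S1 : 1 <> 0 :> S.
  move=> e10; apply: M0; apply/seteqP; split=> [x _|_ ->] /=.
    by rewrite -[x]mulr1 e10 mulr0.
  by case: Mi.
have J1 : jacobson S <> setT.
  by move=> e; apply: (jacobson_proper S1); rewrite e.
have [J0|J0] := pselect (jacobson S = [set 0]); last first.
  by right; apply: Muniq; split=> //; apply: jacobson_ideal.
left; have [m [Mm m0]] : exists m, M m /\ m <> 0.
  apply: contrapT => no; apply: M0; apply/seteqP; split=> [m Mm|_ ->] /=.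
    by apply: contrapT => m0; apply: no; exists m.
  by case: Mi.
have [N Nmax nNm] : exists2 N, is_maximal_left_ideal N & ~ N m.
  apply: contrapT => no; apply: m0.
  suff : jacobson S m by rewrite J0.
  by move=> N Nmax; apply: contrapT => nNm; apply: no; exists N.
apply: (primitive_of_maximal_left Nmax) => K Ki KN; apply: contrapT => K0.
have [[_ _ _] NneT _] := Nmax.
apply: nNm; apply: (KN); suff -> : K = M by [].
apply: Muniq; split=> // [e|e]; first by apply: K0; rewrite e.
by apply: NneT; apply/seteqP; split=> // x _; apply: KN; rewrite e.
Qed.

Lemma division_subring_ideal_add (S : pzRingType) (D : subringClosed S)
    (K : set S) :
  maximal_subring D -> division_ring (subring_sort D) ->
  nonzero_proper_ideal K ->
  (forall x, x \in D -> K x -> x = 0) /\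
  (forall s, exists d k, [/\ d \in D, K k & s = d + k]).
Proof.
move=> maxD [_ divD] [Ki K0 KneT]; have [Kz _ Kl _] := Ki.
have DK x : x \in D -> K x -> x = 0.
  move=> Dx Kx; apply: contrapT => x0; apply: KneT.
  have [|y [_ /(congr1 val) yx]] := divD (Sub x Dx).
    by move=> /(congr1 val).
  apply: left_ideal1; first exact: left_ideal_of_ideal.
  by have <- : val y * x = 1 by []; apply: Kl.
split=> //; apply: maximal_subring_add => // KD; apply: K0.
by apply/seteqP; split=> [x Kx|_ ->] //=; apply: DK => //; apply: KD.
Qed.

(** If K ∩ L were nonzero, then S = D + (K ∩ L). The [D]-component of an element of [K] would lie in
    K ∩ D = 0, so [K] would equal K ∩ L; likewise [L]. *)
Lemma division_subring_ideals_cap (S : pzRingType) (D : subringClosed S)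
    (K L : set S) :
  maximal_subring D -> division_ring (subring_sort D) ->
  nonzero_proper_ideal K -> nonzero_proper_ideal L -> K <> L ->
  K `&` L = [set 0].
Proof.
move=> maxD divD Kp Lp KneL; have [Ki K0 KneT] := Kp; have [Li L0 LneT] := Lp.
apply: contrapT => KL0; apply: KneL.
have KLp : nonzero_proper_ideal (K `&` L).
  split=> //; first exact: ideal_cap.
  move=> e; apply: KneT; apply/seteqP; split=> // x _.
  by have [] : (K `&` L) x by rewrite e.
have [_ add] := division_subring_ideal_add maxD divD KLp.
have sub (N : set S) : nonzero_proper_ideal N -> K `&` L `<=` N ->
    N `<=` K `&` L.
  move=> Np KLN x Nx; have [DN _] := division_subring_ideal_add maxD divD Np.
  have [d [k [Dd KLk ex]]] := add x.
  rewrite ex (DN d) ?add0r //; have -> : d = x - k by rewrite ex addrK.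
  by have [[_ NB _ _] _ _] := Np; apply: NB => //; apply: KLN.
apply/seteqP; split=> x Nx.
  by have [] : (K `&` L) x by apply: (sub K) => // y [].
by have [] : (K `&` L) x by apply: (sub L) => // y [].
Qed.

(** * Ideals above the kernel of a map onto a matrix ring *)

Section MatrixIdeals.
Variables (A S : pzRingType) (n : nat) (g : {rmorphism A -> 'M[S]_n}).
Hypothesis n_gt0 : (0 < n)%N.
Hypothesis g_surj : forall M, exists a, g a = M.

Definition matrix_ideal (K : set S) : set A := [set a | forall i j, K (g a i j)].

Lemma matrix_ideal_is_ideal K : is_ideal K -> is_ideal (matrix_ideal K).
Proof.
move=> Ki; have [K0 KB Kl Kr] := Ki; have KL := left_ideal_of_ideal Ki.
split=> [i j|x y Kx Ky i j|t x Kx i j|t x Kx i j].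
- by rewrite rmorph0 mxE.
- by rewrite rmorphB !mxE; apply: KB.
- by rewrite rmorphM mxE; apply: left_ideal_sum => // k; apply: Kl.
- by rewrite rmorphM mxE; apply: left_ideal_sum => // k; apply: Kr.
Qed.

Lemma matrix_ideal_mono K L : K `<=` L -> matrix_ideal K `<=` matrix_ideal L.
Proof. by move=> KL a Ka i j; apply: KL. Qed.

(** Preimages of scalar matrices are the test elements; [n_gt0] provides a diagonal entry to
    read. *)
Lemma matrix_ideal_sub K L : is_ideal K ->
  matrix_ideal K `<=` matrix_ideal L -> K `<=` L.
Proof.
move=> [K0 _ _ _] KL s Ks; have [a ga] := g_surj s%:M.
have := KL a _ (Ordinal n_gt0) (Ordinal n_gt0).
rewrite ga mxE eqxx; apply => i j.
by rewrite ga mxE; case: eqP.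
Qed.

Lemma matrix_ideal0 : matrix_ideal [set 0] = [set a | g a = 0].
Proof.
apply/seteqP; split=> a /= ga; first by apply/matrixP => i j; rewrite ga mxE.
by move=> i j; rewrite ga mxE.
Qed.

Lemma matrix_idealT : matrix_ideal setT = setT.
Proof. by apply/seteqP; split. Qed.

(** The ideal [K] consists of the scalars whose scalar matrix comes from [N]. As [N] contains the
    kernel, membership in [N] depends only on the image under [g]. *)
Lemma matrix_ideal_surj N : is_ideal N -> (forall a, g a = 0 -> N a) ->
  exists2 K, is_ideal K & N = matrix_ideal K.
Proof.
move=> Ni kerN; have [N0 NB Nl Nr] := Ni; have NL := left_ideal_of_ideal Ni.
have Ker a b : N a -> g a = g b -> N b.
  move=> Na e; rewrite -(subKr a b); apply: NB => //; apply: kerN.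
  by rewrite rmorphB e subrr.
pose K := [set s | exists2 a, N a & g a = s%:M].
have entryK a i j : N a -> K (g a i j).
  move=> Na.
  (* Summing [delta_mx k i * g a * delta_mx j k] over [k] moves the (i, j) entry to every diagonal
     position. *)
  have [b gb] := boolp.choice (fun k => g_surj (delta_mx k i)).
  have [c gc] := boolp.choice (fun k => g_surj (delta_mx j k)).
  exists (\sum_k b k * a * c k).
    by apply: left_ideal_sum => // k; apply: Nr; apply: Nl.
  rewrite rmorph_sum; apply/matrixP => p q; rewrite summxE.
  under eq_bigr => k _.
    rewrite !rmorphM gb gc !mxE (bigD1 j)//= big1 ?addr0; last first.
      by move=> l lj; rewrite [X in _ * X]mxE (negPf lj) mulr0.
    rewrite !mxE eqxx (bigD1 i)//= big1 ?addr0; last first.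
      by move=> l li; rewrite [X in X * _]mxE (negPf li) andbF mul0r.
    rewrite mxE eqxx andbT /=.
    over.
  rewrite (bigD1 p)//= big1 ?addr0; last first.
    by move=> k kp; rewrite eq_sym (negPf kp) !mul0r.
  by rewrite mxE eqxx mul1r mulr_natr eq_sym.
exists K.
  split=> [|x y [a Na ga] [b Nb gb]|t x [a Na ga]|t x [a Na ga]].
  - by exists 0; rewrite ?rmorph0 ?raddf0.
  - by exists (a - b); [exact: NB|rewrite rmorphB ga gb raddfB].
  - have [b gb] := g_surj t%:M; exists (b * a); first exact: Nl.
    by rewrite rmorphM ga gb scalar_mxM.
  - have [b gb] := g_surj t%:M; exists (a * b); first exact: Nr.
    by rewrite rmorphM ga gb scalar_mxM.
apply/seteqP; split=> [a Na i j|a Ka]; first exact: entryK.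
have [b bP] := boolp.choice (fun ij : 'I_n * 'I_n => g_surj (delta_mx ij.1 ij.2)).
have /boolp.choice[c cP] (ij : 'I_n * 'I_n) :
    exists c, N c /\ g c = (g a ij.1 ij.2)%:M.
  by have [c] := Ka ij.1 ij.2; exists c.
apply: (Ker (\sum_i \sum_j c (i, j) * b (i, j))).
  apply: left_ideal_sum => // i; apply: left_ideal_sum => // j.
  by apply: Nr; have [] := cP (i, j).
rewrite rmorph_sum [RHS]matrix_sum_delta; apply: eq_bigr => i _.
rewrite rmorph_sum; apply: eq_bigr => j _.
by rewrite rmorphM bP (cP (i, j)).2 -mul_scalar_mx.
Qed.

(** The correspondence takes the greatest proper ideal of [S] to the greatest proper ideal of [A]
    above the kernel, which is then the only maximal one there. *)
Lemma matrix_ideal_maximal K0 : is_ideal K0 -> K0 <> setT ->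
  (forall K, is_ideal K -> K <> setT -> K `<=` K0) ->
  is_maximal_ideal (matrix_ideal K0) /\
  forall N, is_maximal_ideal N -> (forall a, g a = 0 -> N a) ->
    N = matrix_ideal K0.
Proof.
move=> K0i K0neT K0max.
have over N : is_ideal N -> (forall a, g a = 0 -> N a) -> N <> setT ->
    N `<=` matrix_ideal K0.
  move=> Ni kerN NneT; have [K Ki eN] := matrix_ideal_surj Ni kerN.
  rewrite eN; apply: matrix_ideal_mono; apply: K0max => // KT.
  by apply: NneT; rewrite eN KT matrix_idealT.
have QneT : matrix_ideal K0 <> setT.
  move=> e; apply: K0neT; apply/seteqP; split=> //.
  apply: matrix_ideal_sub; last by rewrite e.
  by split.
split=> [|N [Ni NneT Nmax] kerN]; last first.
  by have [|//|//] := Nmax _ (matrix_ideal_is_ideal K0i); first exact: over.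
split=> //; first exact: matrix_ideal_is_ideal.
move=> N Ni QN; have [->|NneT] := pselect (N = setT); [by right|left].
apply/seteqP; split=> //; apply: over => // a ga; apply: QN => i j.
by rewrite ga mxE; case: K0i.
Qed.

Lemma matrix_ideal_nonzero_proper K : nonzero_proper_ideal K ->
  [/\ is_ideal (matrix_ideal K), matrix_ideal K <> setT &
      ~ matrix_ideal K `<=` [set a | g a = 0]].
Proof.
move=> [Ki K0 KneT]; split; first exact: matrix_ideal_is_ideal.
  move=> e; apply: KneT; apply/seteqP; split=> //.
  by apply: matrix_ideal_sub; [split|rewrite e].
rewrite -matrix_ideal0 => sub; apply: K0; apply/seteqP; split.
  exact: matrix_ideal_sub.
by move=> _ ->; case: Ki.
Qed.

End MatrixIdeals.

Lemma matrix_at_most_one_ideal (A S : pzRingType) n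
    (g : {rmorphism A -> 'M[S]_n}) :
  (0 < n)%N -> bijective g ->
  at_most_one_nonzero_proper_ideal S -> at_most_one_nonzero_proper_ideal A.
Proof.
move=> n0 [h gK hK] one I J [Ii I0 IneT] [Ji J0 JneT].
have g_surj M : exists a, g a = M by exists (h M).
have g0 a : g a = 0 -> a = 0.
  by move=> ga; apply: (can_inj gK); rewrite ga rmorph0.
have nz N : is_ideal N -> N <> [set 0] -> N <> setT ->
    exists2 K, nonzero_proper_ideal K & N = matrix_ideal g K.
  move=> Ni N0 NneT; have [a /g0 ->|K Ki eN] := matrix_ideal_surj g_surj Ni.
    by case: Ni.
  exists K => //; split=> // eK.
    apply: N0; rewrite eN eK matrix_ideal0; apply/seteqP; split=> [a /g0//|a ->].
    exact: rmorph0.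
  by apply: NneT; rewrite eN eK matrix_idealT.
have [K Kp ->] := nz I Ii I0 IneT; have [L Lp ->] := nz J Ji J0 JneT.
by rewrite (one K L).
Qed.

Lemma quot_proj_is_monoid_morphism (T : pzRingType) (I : ideal T) :
  monoid_morphism (quot_proj I).
Proof. by split=> // x y; apply: quot_projM. Qed.

HB.instance Definition _ (T : pzRingType) (I : ideal T) :=
  GRing.isZmodMorphism.Build T (ring_quot I) (quot_proj I) (quot_projB I).
HB.instance Definition _ (T : pzRingType) (I : ideal T) :=
  GRing.isMonoidMorphism.Build T (ring_quot I) (quot_proj I)
    (quot_proj_is_monoid_morphism I).

(** The square of [M] is an ideal inside [M], hence proper, so it is 0 or [M]. *)
Lemma at_most_one_ideal_trichotomy (S : pzRingType) :
  1 <> 0 :> S -> at_most_one_nonzero_proper_ideal S ->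
  simple_ring S \/ exists M : set S, unique_nonzero_proper_ideal M /\
    (ideal_mul M M = [set 0] \/ ideal_mul M M = M).
Proof.
move=> S1 one.
have [[M Mp]|none] := pselect (exists M : set S, nonzero_proper_ideal M).
  right; exists M; split; first by split=> // I Ip; apply: one.
  have [Mi M0 MneT] := Mp.
  have [->|M20] := pselect (ideal_mul M M = [set 0]); [by left|right].
  apply: one => //; split=> //; first exact: is_ideal_mul.
  move=> e; apply: MneT; apply/seteqP; split=> // x _.
  by apply: (ideal_mul_subl Mi (J := M)); rewrite e.
left; split=> // I Ii.
have [->|I0] := pselect (I = [set 0]); [by left|right].
by apply: contrapT => IneT; apply: none; exists I.
Qed.

Theorem theorem4p9 (T : pzRingType) (R : subringClosed T)
    (maxR : maximal_subring R)
    (artR : left_artinian (subring_sort R))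
    (conductor_lE : conductor_l R = conductor R)
    (conductor_rE : conductor R = conductor_r R) :
  exists (S : pzRingType) (n : nat),
    [/\ (0 < n)%N /\ ring_iso (ring_quot (conductor_ideal R)) 'M[S]_n,
        exists D : subringClosed S,
          maximal_subring D /\ division_ring (subring_sort D),
        left_artinian T ->
          val @` jacobson (subring_sort R) = jacobson T `&` [set` R],
        left_artinian T \/
        [/\ at_most_one_nonzero_proper_ideal S,
            at_most_one_nonzero_proper_ideal (ring_quot (conductor_ideal R)) &
            [\/ simple_ring S /\ is_maximal_ideal (conductor R),
                exists M : set S,
                  [/\ unique_nonzero_proper_ideal M,
                      ideal_mul M M = [set 0] & jacobson S = M] |
                exists M : set S,
                  [/\ unique_nonzero_proper_ideal M,
                      ideal_mul M M = M &
                      primitive_ring S \/ jacobson S = M]]] &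
        [\/ simple_ring S,
            exists M : set S,
              unique_nonzero_proper_ideal M /\ ideal_mul M M = [set 0] |
            exists M : set S,
              unique_nonzero_proper_ideal M /\ ideal_mul M M = M] ->
        exists Q : set T,
          [/\ is_maximal_ideal Q, conductor R `<=` Q &
              forall Q', is_maximal_ideal Q' -> conductor R `<=` Q' -> Q' = Q]
          /\
          [/\ Max T = [set Q] `|` [set N | Spec T N /\ ~ (N `<=` [set` R])],
              (forall P, Spec T P -> Max T P \/ P `<=` Q)
                /\ krull_dim T = height Q,
              forall N1 N2, Max T N1 -> Max T N2 -> N1 <> N2 ->
                N1 <> Q -> N2 <> Q ->
                N1 `&` [set` R] <> N2 `&` [set` R] &
              Max T #<= Max (subring_sort R)]].
Proof.
have Imax := conductor_maximal_in_subring maxR artR conductor_lE conductor_rE.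
set I := conductor_ideal R.
have IR : I `<=` [set` R] := @conductor_sub _ R.
have [S [n [n0 [f f_bij] [D [maxD divD]]]]] :=
  prime_artinian_matrix (quot_subring_maximal IR maxR)
    (conductor_quot_prime maxR conductor_lE conductor_rE)
    (quot_subring_artinian (I := I) artR).
(* Composing with the projection gives a map on [T] itself with kernel the conductor, so ideals of
   [S] pull back directly to ideals of [T]. *)
pose g : {rmorphism T -> 'M[S]_n} := f \o quot_proj I.
have f_inj := bij_inj f_bij.
have g_surj M : exists a, g a = M.
  have [h _ hK] := f_bij; have [a ea] := quot_proj_surj (h M).
  by exists a; rewrite /g /= ea hK.
have g0 a : g a = 0 <-> conductor R a.
  rewrite /g /=; split=> [ga|Ia].
    by apply/(quot_proj_eq0 I); apply: f_inj; rewrite ga rmorph0.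
  by rewrite (_ : quot_proj I a = 0) ?rmorph0 //; apply/quot_proj_eq0.
have kerE : [set a | g a = 0] = conductor R.
  by apply/seteqP; split=> a; have [] := g0 a.
have S1 : 1 <> 0 :> S.
  move=> e; have [D1 _] := divD; apply: D1; exact: val_inj.
have greatest K0 : is_ideal K0 -> K0 <> setT ->
    (forall K, is_ideal K -> K <> setT -> K `<=` K0) ->
    is_maximal_ideal (matrix_ideal g K0) /\
    forall N, is_maximal_ideal N -> conductor R `<=` N -> N = matrix_ideal g K0.
  move=> K0i K0neT K0max.
  have [Qmax Quniq] := matrix_ideal_maximal n0 g_surj K0i K0neT K0max.
  by split=> // N Nmax IN; apply: Quniq => // a /g0; apply: IN.
have T0 : [set 0 : S] <> setT.
  by move=> e; apply: S1; have : [set 0 : S] 1 by rewrite e.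
have simple_greatest : simple_ring S ->
    forall K : set S, is_ideal K -> K <> setT -> K `<=` [set 0].
  by move=> [_ Ss] K Ki KneT; have [->|] := Ss K Ki.
exists S, n; split.
- by split=> //; exists f.
- by exists D.
- exact: jacobson_trace.
- have [|nartT] := pselect (left_artinian T); [by left|right].
  have one : at_most_one_nonzero_proper_ideal S.
    (* Distinct [K] and [L] meet in 0, so their pullbacks to [T] meet in the conductor, hence inside
       [R], while neither pullback lies in [R]. *)
    move=> K L Kp Lp; apply: contrapT => KneL; apply: nartT.
    have [Ki KneT nK] := matrix_ideal_nonzero_proper n0 g_surj Kp.
    have [Li LneT nL] := matrix_ideal_nonzero_proper n0 g_surj Lp.
    rewrite kerE in nK nL.
    apply: (artinian_of_two_ideals maxR artR Ki Li) => [x [Kx Lx]|KR|LR].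
    + apply: conductor_sub; rewrite -kerE -matrix_ideal0 => i j.
      rewrite -(division_subring_ideals_cap maxD divD Kp Lp KneL).
      by split; [apply: Kx|apply: Lx].
    + by apply: nK; apply: ideal_sub_conductor.
    + by apply: nL; apply: ideal_sub_conductor.
  split=> //; first exact: (matrix_at_most_one_ideal n0 f_bij).
  have [Ss|[M [Mu [M2|M2]]]] := at_most_one_ideal_trichotomy S1 one.
  + apply: Or31; split=> //.
    have [Qmax _] := greatest _ (ideal_zero S) T0 (simple_greatest Ss).
    by rewrite matrix_ideal0 kerE in Qmax.
  (* As [M] squares to 0, the radical contains [M] and is nonzero; being proper, it equals [M]. *)
  + apply: Or32; exists M; split=> //; have [[Mi M0 MneT] Muniq] := Mu.
    apply: Muniq; split; first exact: jacobson_ideal.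
      move=> e; apply: M0; apply/seteqP; split=> [x|_ ->].
        by rewrite -e; apply: jacobson_square_zero.
      by case: Mi.
    by move=> e; apply: (jacobson_proper S1); rewrite e.
  + apply: Or33; exists M; split=> //; exact: unique_ideal_jacobson.
move=> cases.
have [Q [[Qmax IQ] Quniq]] : exists Q : set T,
    (is_maximal_ideal Q /\ conductor R `<=` Q) /\
    forall Q', is_maximal_ideal Q' -> conductor R `<=` Q' -> Q' = Q.
  (* In each case [S] has a greatest proper ideal: 0 if it is simple, [M] otherwise. [Q] is its
     pullback. *)
  have [K0 [K0i K0neT K0max]] : exists K0 : set S, [/\ is_ideal K0, K0 <> setT &
      forall K, is_ideal K -> K <> setT -> K `<=` K0].
    have uniq M : unique_nonzero_proper_ideal M ->
        [/\ is_ideal M, M <> setT & forall K, is_ideal K -> K <> setT -> K `<=` M].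
      move=> [[Mi M0 MneT] Muniq]; split=> // K Ki KneT.
      have [->|K0] := pselect (K = [set 0]); last by rewrite (Muniq K).
      by move=> _ ->; case: Mi.
    case: cases => [Ss|[M [Mu _]]|[M [Mu _]]]; last 2 first.
    - by exists M; apply: uniq.
    - by exists M; apply: uniq.
    by exists [set 0]; split=> //; [exact: ideal_zero|exact: simple_greatest].
  have [Qmax Quniq] := greatest _ K0i K0neT K0max.
  exists (matrix_ideal g K0); do 2!split=> //.
  rewrite -kerE -matrix_ideal0; apply: matrix_ideal_mono => _ ->.
  by case: K0i.
exists Q; split=> //; split.
- exact: (Max_decomposition maxR artR Qmax IQ).
- split; first by move=> P; apply: (prime_max_or_sub maxR artR IQ).
  exact: (krull_dim_height maxR artR Qmax IQ).
- move=> N1 N2 N1max N2max N12 N1Q N2Q e; apply: N12.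
  exact: (maximal_trace_inj Quniq).
- exact: (card_Max_le maxR artR Qmax IQ Quniq Imax).
Qed.
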